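(* Let $(M,\tilde\varphi,\xi,\eta,\tilde g)$ be a positive or negative definite paracontact $(\tilde\kappa,\tilde\mu)$-manifold such that $\tilde\kappa<-1$. Then $M$ carries a canonical contact Riemannian structure $(\phi,\xi,\eta,g)$ given by $$\phi:=\pm\frac{1}{\sqrt{-1-\tilde\kappa}}\tilde h,\qquad g:=-d\eta(\cdot,\phi\,\cdot)+\eta\otimes\eta,$$ where the sign $\pm$ depends on the positive or negative definiteness of the paracontact $(\tilde\kappa,\tilde\mu)$-manifold ($+$ in the positive definite case, $-$ in the negative definite case). Moreover, $(\phi,\xi,\eta,g)$ is a contact metric $(\kappa,\mu)$-structure, where $$\kappa=\tilde\kappa+2-\Bigl(1-\frac{\tilde\mu}{2}\Bigr)^2,\qquad \mu=2.$$
   Context: Conventions: $2d\eta(X,Y)=X(\eta(Y))-Y(\eta(X))-\eta([X,Y])$; $R_{XY}Z=\nabla_X\nabla_YZ-\nabla_Y\nabla_XZ-\nabla_{[X,Y]}Z$. An almost paracontact structure on a $(2n+1)$-dimensional manifold $M$ is a triple $(\tilde\varphi,\xi,\eta)$, with $\tilde\varphi$ a $(1,1)$-tensor field, $\xi$ a vector field and $\eta$ a 1-form, such that $\eta(\xi)=1$, $\tilde\varphi^2=I-\eta\otimes\xi$ and the $\pm1$-eigendistributions $\mathcal D^{\pm}$ of $\tilde\varphi$ on $\mathcal D=\ker\eta$ both have dimension $n$. Together with a pseudo-Riemannian metric $\tilde g$ satisfying $\tilde g(\tilde\varphi X,\tilde\varphi Y)=-\tilde g(X,Y)+\eta(X)\eta(Y)$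 and $d\eta(X,Y)=\tilde g(X,\tilde\varphi Y)$ it is a paracontact metric structure. Put $\tilde h=\frac12\mathcal L_\xi\tilde\varphi$, where $\mathcal L$ is the Lie derivative. A paracontact $(\tilde\kappa,\tilde\mu)$-manifold ($\tilde\kappa,\tilde\mu$ real constants) is a paracontact metric manifold for which the curvature tensor $\tilde R$ of the Levi-Civita connection of $\tilde g$ satisfies $\tilde R_{XY}\xi=\tilde\kappa(\eta(Y)X-\eta(X)Y)+\tilde\mu(\eta(Y)\tilde hX-\eta(X)\tilde hY)$ for all vector fields $X,Y$. A Legendre foliation $\mathcal F$ of the contact manifold $(M,\eta)$ is an integrable $n$-dimensional subbundle of $\mathcal D$ on which $d\eta$ vanishes. Its Pang invariant is the symmetric bilinear form $\Pi_{\mathcal F}(X,X')=-(\mathcal L_X\mathcal L_{X'}\eta)(\xi)=2d\eta([\xi,X],X')$ on the tangent bundle of $\mathcal F$, and $\mathcal F$ is called positive (negative) definite if $\Pi_{\mathcal F}$ is positive (negative) definite. On a paracontact $(\tilde\kappa,\tilde\mu)$-manifold with $\tilde\kappa\neq-1$ the distributions $\mathcal D^{+}$ and $\mathcal D^{-}$ are Legendre foliations. The manifold is called positive definite (respectively, negative definite) if the bi-Legendrian structure $(\mathcal D^{+},\mathcal D^{-})$ is positive (respectively, negative) definite, that is, if both $\mathcal D^{+}$ and $\mathcal D^{-}$ are positive (respectively, negative) definite. When $\tilde\kappa<-1$, $\tilde\varphi\tilde h$ is diagonalizable with eigenvalues $0$ (eigenspace $\mathbb R\xi$) and $\pm\sqrt{-1-\tilde\kappa}$,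 each of the latter with multiplicity $n$; it is assumed throughout that the index of $\tilde g$ restricted to each of the two $n$-dimensional eigendistributions is constant on $M$. A contact Riemannian (contact metric) structure $(\varphi,\xi,\eta,g)$ consists of a contact form $\eta$ with Reeb field $\xi$, a $(1,1)$-tensor field $\varphi$ and a Riemannian metric $g$ with $\varphi^2=-I+\eta\otimes\xi$, $\varphi\xi=0$, $\eta=g(\cdot,\xi)$, $g(\varphi X,\varphi Y)=g(X,Y)-\eta(X)\eta(Y)$, $g(X,\varphi Y)=d\eta(X,Y)$. With $h=\frac12\mathcal L_\xi\varphi$, it is a contact metric $(\kappa,\mu)$-structure ($\kappa,\mu$ real constants) if the curvature tensor $R$ of $g$ satisfies $R_{XY}\xi=\kappa(\eta(Y)X-\eta(X)Y)+\mu(\eta(Y)hX-\eta(X)hY)$ for all $X,Y$.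
   Formalization: As defined, positive (negative) definiteness of both D⁺ and D⁻ is impossible for κ̃<−1, n≥1 (Π on D⁻ at h̃X is (1+κ̃) times Π on D⁺ at X); here D⁺ is positive (negative) definite and D⁻ is definite of either sign, and the sign of φ is that of D⁺. *)

(* Defs.v *)
From HB Require Import structures.
From mathcomp Require Import all_boot all_order all_algebra all_fingroup.
From mathcomp Require Import all_classical all_reals all_analysis.
Set Implicit Arguments.
Unset Strict Implicit.
Unset Printing Implicit Defensive.
Import Order.TTheory GRing.Theory Num.Theory.
Import numFieldNormedType.Exports.
Local Open Scope classical_set_scope.
Local Open Scope ring_scope.

Section Ck.
Context {R : realType} {m : nat}.
Implicit Types (U : set 'rV[R]_m) (f g : 'rV[R]_m -> R^o).

Definition ebasis (i : 'I_m) : 'rV[R]_m := delta_mx ord0 i.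

Fixpoint Ck (k : nat) U f : Prop :=
  (forall x, U x -> {for x, continuous f}) /\
  if k is j.+1 then
    forall i, (forall x, U x -> derivable f x (ebasis i)) /\
              Ck j U (fun x => 'D_(ebasis i) f x)
  else True.

Definition Cinfty U f := forall k, Ck k U f.

Lemma Ck_eq k U f g : open U -> (forall x, U x -> f x = g x) ->
  Ck k U f -> Ck k U g.
Proof.
move=> oU; have nU x : U x -> nbhs x U by move=> Ux; apply: open_nbhs_nbhs.
elim: k f g => [|k IH] f g fg /= [cf df].
all: have nfg x : U x -> {near x, f =1 g}
  by move=> /nU; apply: filterS => y /fg.
all: have cg x : U x -> {for x, continuous g}
  by move=> Ux; rewrite /prop_for /continuous_at -(fg x Ux);
     apply: (cvg_trans _ (cf x Ux));
     exact: (@near_eq_cvg _ _ (nbhs x) _ f g (nfg x Ux)).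
all: split=> // i.
have [dfi Cfi] := df i; split.
  by move=> x Ux; apply: near_eq_derivable (dfi x Ux); exact: nfg.
by apply: IH Cfi => x Ux; apply: near_eq_derive; exact: nfg.
Qed.

Lemma CkS k U f : Ck k.+1 U f -> Ck k U f.
Proof.
elim: k f => [|k IH] f [cf df]; first by split.
by split=> // i; have [? ?] := df i; split=> //; apply: IH.
Qed.

Lemma Ck_cst k U (c : R) : Ck k U (fun=> c).
Proof.
have cc (x : 'rV[R]_m) : {for x, continuous (fun=> c : R^o)} by exact: (@cvg_cst _ c _ (nbhs x)).
elim: k c cc => [|k IH] c cc /=; split=> // i.
split; first by move=> x _; apply: ex_derive.
have D0 : (fun x => 'D_(ebasis i) (fun=> c : R^o) x) = fun=> 0.
  by apply/funext => x; exact: (@derive_val _ _ _ _ _ _ _ (is_derive_cst _ _ _)).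
rewrite D0.
by apply: IH => x; exact: (@cvg_cst _ 0 _ (nbhs x)).
Qed.

Lemma CkD k U f g : open U -> Ck k U f -> Ck k U g -> Ck k U (f + g).
Proof.
move=> oU; elim: k f g => [|k IH] f g /= [cf df] [cg dg].
all: split; first by move=> x Ux; apply: continuousD; [exact: cf|exact: cg].
  by [].
move=> i; have [dfi Cfi] := df i; have [dgi Cgi] := dg i; split.
  by move=> x Ux; apply: derivableD; [exact: dfi|exact: dgi].
apply: Ck_eq (IH _ _ Cfi Cgi) => // x Ux.
by rewrite deriveD //; [exact: dfi|exact: dgi].
Qed.

Lemma CkM k U f g : open U -> Ck k U f -> Ck k U g -> Ck k U (f * g).
Proof.
move=> oU; elim: k f g => [|k IH] f g.
all: move=> /[dup] Cf [cf df] /[dup] Cg [cg dg].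
all: split; first by move=> x Ux; apply: continuousM; [exact: cf|exact: cg].
  by [].
move=> i; have [dfi Cfi] := df i; have [dgi Cgi] := dg i; split.
  by move=> x Ux; apply: derivableM; [exact: dfi|exact: dgi].
apply: Ck_eq (CkD oU (IH _ _ (CkS Cf) Cgi) (IH _ _ (CkS Cg) Cfi)) => // x Ux.
by rewrite deriveM //; [exact: dfi|exact: dgi].
Qed.

End Ck.

(* The inverse [cinv] of a chart is a total function; only its values on the
   open image [ccod] matter. *)
Record chart (R : realType) (m : nat) (T : topologicalType) := Chart {
  cdom : set T;
  ccod : set 'rV[R]_m;
  cmap : T -> 'rV[R]_m;
  cinv : 'rV[R]_m -> T;
  cdom_open : open cdom;
  ccod_open : open ccod;
  cmapP : forall x, cdom x -> ccod (cmap x) /\ cinv (cmap x) = x;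
  cinvP : forall y, ccod y -> cdom (cinv y) /\ cmap (cinv y) = y;
  cmap_continuous : forall x, cdom x -> {for x, continuous cmap};
  cinv_continuous : forall y, ccod y -> {for y, continuous cinv} }.

Record manifold (R : realType) (m : nat) := Manifold {
  points :> topologicalType;
  manifold_hausdorff : hausdorff_space points;
  manifold_second_countable : @second_countable points;
  atlas : set (chart R m points);
  atlas_cover : forall x, exists2 c, atlas c & cdom c x;
  atlas_compatible : forall c d, atlas c -> atlas d -> forall i : 'I_m,
    Cinfty [set y | ccod c y /\ cdom d (cinv c y)]
           (fun y => cmap d (cinv c y) ord0 i) }.

Section SmoothFunctions.
Context {R : realType} {m : nat} (M : manifold R m).

Definition is_smooth (f : M -> R) :=
  forall c, atlas c -> Cinfty (ccod c) (f \o cinv c).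

Definition smooth_pred : {pred M -> R} := [pred f | `[< is_smooth f >]].

Lemma smooth_subring_closed : subring_closed smooth_pred.
Proof.
have smM f g : is_smooth f -> is_smooth g -> is_smooth (f * g).
  by move=> sf sg c Ac k; apply: CkM (sf c Ac k) (sg c Ac k); exact: ccod_open.
have smN f : is_smooth f -> is_smooth (- f).
  move=> sf; rewrite -mulN1r; apply: smM => // c _ k.
  exact: (Ck_cst k (ccod c) (- 1)).
split; first by apply/asboolP => c _ k; exact: (Ck_cst k (ccod c) 1).
  move=> f g /asboolP sf /asboolP sg; apply/asboolP => c Ac k.
  by apply: CkD (sf c Ac k) (smN g sg c Ac k); exact: ccod_open.
by move=> f g /asboolP sf /asboolP sg; apply/asboolP; exact: smM.
Qed.

(* The ring C^oo(M) *)
Record smooth_fun := SmoothFun {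
  smooth_val :> M -> R;
  smooth_valP : smooth_val \in smooth_pred }.

HB.instance Definition _ := [isSub for smooth_val].
HB.instance Definition _ := gen_eqMixin smooth_fun.
HB.instance Definition _ := gen_choiceMixin smooth_fun.
HB.instance Definition _ := GRing.SubChoice_isSubComPzRing.Build
  (M -> R) smooth_pred smooth_fun smooth_subring_closed.

Lemma smooth_cst_subproof (c : R) : (fun=> c) \in smooth_pred.
Proof. by apply/asboolP => d _ k; exact: (Ck_cst k (ccod d) c). Qed.

Definition smooth_cst (c : R) : smooth_fun := SmoothFun (smooth_cst_subproof c).

Local Notation C := smooth_fun.
Local Notation "c %:S" := (smooth_cst c) (at level 2, format "c %:S").

(* Vector fields are the R-linear derivations of C^oo(M). *)
Definition derivation (X : C -> C^o) :=
  (forall (c : R) f g, X (c%:S * f + g) = c%:S * X f + X g) /\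
  (forall f g, X (f * g) = X f * g + f * X g).

Definition derivation_pred : {pred C -> C^o} := [pred X | `[< derivation X >]].

Lemma derivation_submod_closed : submod_closed derivation_pred.
Proof.
split.
  by apply/asboolP; split=> *; rewrite /= ?mulr0 ?mul0r ?addr0.
move=> a X Y /asboolP [linX leibX] /asboolP [linY leibY].
apply/asboolP; split=> [c f g|f g].
  rewrite !fctE /= /GRing.scale /= linX linY !mulrDr.
  by rewrite addrACA (mulrCA c%:S).
rewrite !fctE /= /GRing.scale /= leibX leibY.
rewrite !mulrDl !mulrDr addrACA.
by rewrite !mulrA (mulrC f a).
Qed.

Record vfield := VField {
  vfield_val : C -> C^o;
  vfield_valP : vfield_val \in derivation_pred }.

HB.instance Definition _ := [isSub for vfield_val].
HB.instance Definition _ := gen_eqMixin vfield.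
HB.instance Definition _ := gen_choiceMixin vfield.
HB.instance Definition _ := GRing.SubChoice_isSubLmodule.Build
  C (C -> C^o) derivation_pred vfield 
  (GRing.submod_closed_semi derivation_submod_closed).

Definition vfield_app (X : vfield) : C -> C := vfield_val X.
Coercion vfield_app : vfield >-> Funclass.

Lemma bracket_subproof (X Y : vfield) :
  ((fun f => X (Y f) - Y (X f)) : C -> C^o) \in derivation_pred.
Proof.
have linE (Z : vfield) c f g : Z (c%:S * f + g) = c%:S * Z f + Z g.
  by have /asboolP [+ _] := vfield_valP Z; apply.
have leibE (Z : vfield) f g : Z (f * g) = Z f * g + f * Z g.
  by have /asboolP [_ +] := vfield_valP Z; apply.
have addE (Z : vfield) f g : Z (f + g) = Z f + Z g.
  by have := linE Z 1 f g; rewrite (_ : 1%:S = 1) ?mul1r //; exact: val_inj.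
apply/asboolP; split=> [c f g|f g].
  by rewrite !linE mulrBr opprD addrACA.
rewrite !leibE !addE !leibE mulrBl mulrBr.
have H (a b d e u v : C) :
  (a + b) + (d + e) - ((u + d) + (b + v)) = (a - u) + (e - v).
  rewrite [d + e]addrC (addrACA a) [b + v]addrC (addrACA u) [d + b]addrC.
  by rewrite opprD (addrACA (a + e)) subrr addr0 opprD addrACA.
exact: H.
Qed.

Definition bracket (X Y : vfield) : vfield := VField (bracket_subproof X Y).

End SmoothFunctions.

Notation "c %:S" := (smooth_cst _ c) (at level 2, format "c %:S").

Section Tensors.
Context {R : realType} {m : nat} {M : manifold R m}.
Local Notation C := (smooth_fun M).
Local Notation X_M := (vfield M).
Implicit Types (p : M) (X Y Z xi : X_M) (f : C) (eta : X_M -> C)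
  (g : X_M -> X_M -> C) (phi h : X_M -> X_M) (D : set X_M).

(* Tensor fields are the C^oo(M)-multilinear maps on vector fields: 1-forms are
   [eta] with [scalar eta], (1,1)-tensors are [phi] with [linear phi].
   A tangent vector at p is the value at p of a vector field, and a
   distribution is given by the set of its sections. *)
Definition eq_at p X Y := forall f, X f p = Y f p.

Definition lincomb k (c : 'I_k -> R) (e : 'I_k -> X_M) : X_M :=
  \sum_i (c i)%:S *: e i.

Definition has_dim_at D p k :=
  exists e : 'I_k -> X_M,
    [/\ forall i, D (e i),
        forall c, eq_at p (lincomb c e) 0 -> forall i, c i = 0
      & forall X, D X -> exists c, eq_at p X (lincomb c e)].

Definition sym_bilinear g :=
  (forall X, scalar (g X)) /\ (forall X Y, g X Y = g Y X).

Definition pseudo_riemannian_metric g :=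
  sym_bilinear g /\
  forall p X, (forall Y, g X Y p = 0) -> eq_at p X 0.

Definition riemannian_metric g :=
  sym_bilinear g /\ forall p X, ~ eq_at p X 0 -> 0 < g X X p.

(* k is the maximal dimension of a subspace of D_p on which g is negative
   definite *)
Definition has_index_at g D p k :=
  let negative j := exists e : 'I_j -> X_M, (forall i, D (e i)) /\
    forall c : 'I_j -> R, (exists i, c i != 0) ->
      g (lincomb c e) (lincomb c e) p < 0 in
  negative k /\ ~ negative k.+1.

Definition constant_index g D := exists k, forall p, has_index_at g D p k.

Definition levi_civita g (nabla : X_M -> X_M -> X_M) :=
  [/\ forall Y, linear (nabla^~ Y),
      forall X f Y Z, nabla X (f *: Y + Z) = X f *: Y + f *: nabla X Y + nabla X Z,
      forall X Y, nabla X Y - nabla Y X = bracket X Y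
    & forall X Y Z, X (g Y Z) = g (nabla X Y) Z + g Y (nabla X Z)].

Definition curvature (nabla : X_M -> X_M -> X_M) X Y Z : X_M :=
  nabla X (nabla Y Z) - nabla Y (nabla X Z) - nabla (bracket X Y) Z.

Definition ext_d eta X Y : C :=
  (2^-1)%:S * (X (eta Y) - Y (eta X) - eta (bracket X Y)).

Definition lie_form X eta : X_M -> C := fun Y => X (eta Y) - eta (bracket X Y).

Definition lie_endo X phi : X_M -> X_M :=
  fun Y => bracket X (phi Y) - phi (bracket X Y).

Definition h_tensor xi phi : X_M -> X_M :=
  fun X => (2^-1)%:S *: lie_endo xi phi X.

(* Covers both the paracontact and the contact Riemannian nullity condition,
   with h = h_tensor xi phi for the respective phi. *)
Definition nullity xi eta g h (k mu : R) :=
  exists2 nabla, levi_civita g nabla &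
    forall X Y, curvature nabla X Y xi =
      k%:S *: (eta Y *: X - eta X *: Y) +
      mu%:S *: (eta Y *: h X - eta X *: h Y).

(* [eigen_distr phi eta c]: the c-eigendistribution of phi on ker eta *)
Definition eigen_distr phi eta (c : R) : set X_M :=
  [set X | eta X = 0 /\ phi X = c%:S *: X].

(* The Pang invariant -(L_X L_X' eta)(xi) of a Legendre foliation *)
Definition pang xi eta X X' : C := - lie_form X (lie_form X' eta) xi.

Definition positive_definite_on xi eta D :=
  forall p X, D X -> ~ eq_at p X 0 -> 0 < pang xi eta X X p.

Definition negative_definite_on xi eta D :=
  forall p X, D X -> ~ eq_at p X 0 -> pang xi eta X X p < 0.

End Tensors.

Section ContactStructures.
Context {R : realType} {n : nat} {M : manifold R n.*2.+1}.
Local Notation C := (smooth_fun M).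
Local Notation X_M := (vfield M).
Implicit Types (xi : X_M) (eta : X_M -> C) (g : X_M -> X_M -> C)
  (phi : X_M -> X_M).

(* The value of eta /\ (d eta)^n on 2n+1 vector fields, up to a nonzero
   constant depending only on n *)
Definition contact_volume eta (X : 'I_n.*2.+1 -> X_M) : C :=
  \sum_(s : 'S_n.*2.+1) (-1) ^+ s * (eta (X (s ord0)) *
    \prod_(i < n) ext_d eta (X (s (inord i.*2.+1))) (X (s (inord i.*2.+2)))).

Definition contact_form eta :=
  scalar eta /\ forall p : M, exists X, contact_volume eta X p != 0.

Definition reeb_field eta xi :=
  eta xi = 1 /\ forall X, ext_d eta xi X = 0.

Definition almost_paracontact phi xi eta :=
  [/\ linear phi, scalar eta, eta xi = 1,
      forall X, phi (phi X) = X - eta X *: xi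
    & forall p, has_dim_at (eigen_distr phi eta 1) p n /\
                has_dim_at (eigen_distr phi eta (- 1)) p n].

Definition paracontact_metric phi xi eta g :=
  [/\ almost_paracontact phi xi eta, pseudo_riemannian_metric g,
      forall X Y, g (phi X) (phi Y) = - g X Y + eta X * eta Y
    & forall X Y, ext_d eta X Y = g X (phi Y)].

Definition paracontact_nullity phi xi eta g (k mu : R) :=
  paracontact_metric phi xi eta g /\
  nullity xi eta g (h_tensor xi phi) k mu.

(* On a paracontact (k, mu)-manifold with k < -1, h^2 = (1 + k) phi^2, hence
   pang (h X) (h X) = (1 + k) pang X X: if one of the two eigendistributions is
   definite, then the other one is definite of the opposite sign, so asking for
   the same sign on both would be contradictory for n > 0. The sign of the
   manifold is therefore the sign on the first one; the second one is required
   to be definite, of either sign, which covers the same-sign reading too. *)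
Definition positive_definite phi xi eta :=
  let Dp := eigen_distr phi eta 1 in
  let Dm := eigen_distr phi eta (- 1) in
  positive_definite_on xi eta Dp /\
  (positive_definite_on xi eta Dm \/ negative_definite_on xi eta Dm).

Definition negative_definite phi xi eta :=
  let Dp := eigen_distr phi eta 1 in
  let Dm := eigen_distr phi eta (- 1) in
  negative_definite_on xi eta Dp /\
  (negative_definite_on xi eta Dm \/ positive_definite_on xi eta Dm).

Definition contact_riemannian phi xi eta g :=
  [/\ contact_form eta, reeb_field eta xi, linear phi, riemannian_metric g &
    [/\ forall X, phi (phi X) = - X + eta X *: xi,
        phi xi = 0,
        forall X, eta X = g X xi,
        forall X Y, g (phi X) (phi Y) = g X Y - eta X * eta Y
      & forall X Y, g X (phi Y) = ext_d eta X Y]].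

Definition contact_nullity phi xi eta g (k mu : R) :=
  contact_riemannian phi xi eta g /\
  nullity xi eta g (h_tensor xi phi) k mu.

End ContactStructures.

(* Main.v *)
Require Import Defs.
From HB Require Import structures.
From mathcomp Require Import all_boot all_order all_algebra all_fingroup.
From mathcomp Require Import all_classical all_reals all_analysis.
From mathcomp Require Import ring lra zify.
Set Implicit Arguments.
Unset Strict Implicit.
Unset Printing Implicit Defensive.
Import Order.TTheory GRing.Theory Num.Theory.
Local Open Scope ring_scope.

(** Write phi, g, h for the paracontact tensors, nabla for the Levi-Civita
    connection of g, and S := nabla xi + phi.

    As 2 d eta (X, Y) = g (nabla_X xi) Y - g (nabla_Y xi) X, the skew part of
    nabla xi is - phi, so S is symmetric; closedness of d eta then gives
    nabla_xi phi = 0, S phi = - phi S and h = phi S. In the Jacobi operator R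
    (., xi) xi, prescribed by the nullity condition, the part commuting with
    phi yields S^2 = - (1 + k) phi^2 and the part anticommuting with phi
    yields nabla_xi S = - mu phi S.

    The heart of the argument is that (nabla_X phi) Y and (nabla_X S) Y are
    multiples of xi for X, Y in ker eta (nabla_phi_horizontal,
    nabla_S_horizontal). Both are tested on triples of eigenvectors of phi:
    closedness of d eta, the Codazzi equation g (R (X, Y) xi) Z = 0 on ker
    eta, and the fact that S exchanges the two eigendistributions leave no
    room for a nonzero value. Hence nabla phi and nabla S are explicit
    (nabla_phi_formula, nabla_S_formula), and phi, S and phi S span, up to
    terms in eta and xi, an algebra closed under composition, transposition
    and covariant differentiation.

    With c = sgn / sqrt (- 1 - k), the new structure is phib = c phi S and gb
    = g (., (- c S + eta xi) .). The Koszul formula for gb can be solved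
    inside that algebra, so the Levi-Civita connection of gb is nabla plus an
    explicit tensor (contact_connection) and its curvature at xi is a
    computation (contact_nullity_curvature).

    Positivity of gb comes from pang X X = 2 s / c gb X X on the
    s-eigendistribution (pang_contact_metric): the sign of c makes gb positive
    on the first one; phib carries the second one isometrically into it, so
    that gb is nonnegative there, and definite as the invariant is. Finally,
    an orthonormal frame e_i of the first eigendistribution at a point
    completes to the symplectic frame (xi, e_i, phib e_i), on which all
    nonzero terms of the contact volume have the same sign (pair_volume_neq0). *)

(** * Functions and vector fields *)
Section Calculus.
Context {R : realType} {m : nat} {M : manifold R m}.
Local Notation C := (smooth_fun M).
Local Notation V := (vfield M).
Implicit Types (f u v : C) (X Y Z : V) (c : R) (p : M).

Lemma smooth_funP u v : (forall p, u p = v p) -> u = v.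
Proof. by move=> uv; apply/val_inj/funext. Qed.

Lemma pt_eq p u v : u = v -> u p = v p.
Proof. by move->. Qed.

Lemma smooth_ev0 p : (0 : C) p = 0. Proof. by []. Qed.
Lemma smooth_ev1 p : (1 : C) p = 1. Proof. by []. Qed.
Lemma smooth_evD u v p : (u + v) p = u p + v p. Proof. by []. Qed.
Lemma smooth_evN u p : (- u) p = - u p. Proof. by []. Qed.
Lemma smooth_evM u v p : (u * v) p = u p * v p. Proof. by []. Qed.
Lemma smooth_evC c p : (c%:S : C) p = c. Proof. by []. Qed.

Lemma smooth_cst0 : 0%:S = 0 :> C. Proof. exact: smooth_funP. Qed.
Lemma smooth_cst1 : 1%:S = 1 :> C. Proof. exact: smooth_funP. Qed.

Definition smooth_evE :=
  (smooth_evD, smooth_evN, smooth_evM, smooth_evC, smooth_ev0, smooth_ev1).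

Lemma vfieldP X Y : (forall f, X f = Y f) -> X = Y.
Proof. by move=> XY; apply/val_inj/funext. Qed.

Lemma vfield_sumD X Y f : (X + Y) f = X f + Y f. Proof. by []. Qed.
Lemma vfield_oppE X f : (- X) f = - X f. Proof. by []. Qed.
Lemma vfield_scaleE u X f : (u *: X) f = u * X f. Proof. by []. Qed.
Lemma vfield_0E f : (0 : V) f = 0. Proof. by []. Qed.
Lemma bracketE X Y f : bracket X Y f = X (Y f) - Y (X f). Proof. by []. Qed.

Definition vfieldE :=
  (vfield_sumD, vfield_oppE, vfield_scaleE, vfield_0E, bracketE).

Lemma vder_linear X c u v : X (c%:S * u + v) = c%:S * X u + X v.
Proof. by have /asboolP [+ _] := vfield_valP X; apply. Qed.

Lemma vderM X u v : X (u * v) = X u * v + u * X v.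
Proof. by have /asboolP [_ +] := vfield_valP X; apply. Qed.

Lemma vderD X u v : X (u + v) = X u + X v.
Proof. by have := vder_linear X 1 u v; rewrite smooth_cst1 !mul1r. Qed.

Lemma vder0 X : X 0 = 0.
Proof. by apply: (addIr (X 0)); rewrite -vderD !add0r. Qed.

Lemma vderN X u : X (- u) = - X u.
Proof. by apply/eqP; rewrite -addr_eq0 -vderD addNr vder0. Qed.

Lemma vder1 X : X 1 = 0.
Proof.
by apply: (addIr (X 1)); rewrite add0r -{3}[1]mulr1 vderM mulr1 mul1r.
Qed.

Lemma vder_cst X c : X c%:S = 0.
Proof.
have := vder_linear X c 1 0; rewrite addr0 mulr1 vder0 addr0 vder1 mulr0.
by [].
Qed.

Definition vderE := (vderD, vderN, vderM, vder_cst, vder0, vder1).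

End Calculus.

(** Identities in C^oo(M) are settled by evaluation at a point, and identities
    between vector fields by application to a function. *)
Ltac fun_ring := let p := fresh "p" in
  apply: smooth_funP => p; rewrite ?smooth_evE; ring.
Ltac fun_field := let p := fresh "p" in
  apply: smooth_funP => p; rewrite ?smooth_evE; field; try done.
Ltac vec_ring := let f := fresh "f" in
  apply: vfieldP => f; rewrite ?vfieldE ?vderE; fun_ring.
Ltac vec_field := let f := fresh "f" in
  apply: vfieldP => f; rewrite ?vfieldE ?vderE; fun_field.

Ltac fun_lra e := let p := fresh "p" in
  apply: smooth_funP => p; have := pt_eq p e; rewrite ?smooth_evE; lra.
Ltac vec_lra e := let f := fresh "f" in
  apply: vfieldP => f; have := congr1 (fun X => vfield_app X f) e;
  rewrite ?vfieldE; let h := fresh "h" in move=> h; fun_lra h.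

Section LinearMaps.
Context {R : realType} {m : nat} {M : manifold R m}.
Local Notation C := (smooth_fun M).
Local Notation V := (vfield M).

Lemma endoE (F : {linear V -> V}) :
  (forall X Y, F (X + Y) = F X + F Y) * (forall X, F (- X) = - F X) *
  (forall (f : C) X, F (f *: X) = f *: F X) * (F 0 = 0).
Proof.
by split; [split; [split|]|]; move=> *;
  rewrite ?linearD ?linearN ?linearZ ?linear0.
Qed.

Lemma formE (F : {scalar V}) :
  (forall X Y, F (X + Y) = F X + F Y) * (forall X, F (- X) = - F X) *
  (forall (f : C) X, F (f *: X) = f * F X) * (F 0 = 0).
Proof.
by split; [split; [split|]|]; move=> *;
  rewrite ?linearD ?linearN ?linearZ ?linear0.
Qed.

End LinearMaps.

(** * Metric connections *)

(** The covariant derivative of the endomorphism [F], locked so that rewriting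
    with the rules of [nabla] leaves it intact. *)
HB.lock Definition cov (R : realType) (m : nat) (M : manifold R m)
    (nabla : vfield M -> vfield M -> vfield M) (F : vfield M -> vfield M)
    (X Y : vfield M) : vfield M :=
  nabla X (F Y) - F (nabla X Y).

Section Metrics.
Context {R : realType} {m : nat} {M : manifold R m}.
Local Notation C := (smooth_fun M).
Local Notation V := (vfield M).
Implicit Types (f u v : C) (X Y Z : V) (c : R) (p : M).

Lemma jacobi X Y Z :
  bracket (bracket X Y) Z + bracket (bracket Y Z) X + bracket (bracket Z X) Y
  = 0.
Proof. by vec_ring. Qed.

Context (g : V -> V -> C) (nabla : V -> V -> V).
Hypotheses (gP : sym_bilinear g) (LC : levi_civita g nabla).

Lemma metricC X Y : g X Y = g Y X. Proof. exact: gP.2. Qed.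
Lemma metricDr X Y Z : g X (Y + Z) = g X Y + g X Z.
Proof. by have := gP.1 X 1 Y Z; rewrite scale1r mul1r. Qed.
Lemma metric0r X : g X 0 = 0.
Proof. by apply: (addIr (g X 0)); rewrite -metricDr !add0r. Qed.
Lemma metricZr X f Y : g X (f *: Y) = f * g X Y.
Proof. by have := gP.1 X f Y 0; rewrite metric0r !addr0. Qed.
Lemma metricNr X Y : g X (- Y) = - g X Y.
Proof. by rewrite -scaleN1r metricZr mulN1r. Qed.
Lemma metricDl X Y Z : g (Y + Z) X = g Y X + g Z X.
Proof. by rewrite !(metricC _ X) metricDr. Qed.
Lemma metric0l X : g 0 X = 0.
Proof. by rewrite metricC metric0r. Qed.
Lemma metricZl X f Y : g (f *: Y) X = f * g Y X.
Proof. by rewrite !(metricC _ X) metricZr. Qed.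
Lemma metricNl X Y : g (- Y) X = - g Y X.
Proof. by rewrite !(metricC _ X) metricNr. Qed.

Definition metricE := (metricDr, metricDl, metricZr, metricZl, metricNr,
  metricNl, metric0r, metric0l).

Lemma nablaDl X Y Z : nabla (X + Y) Z = nabla X Z + nabla Y Z.
Proof. by case: LC => /(_ Z 1 X Y); rewrite !scale1r. Qed.
Lemma nabla0l Z : nabla 0 Z = 0.
Proof. by apply: (addIr (nabla 0 Z)); rewrite -nablaDl !add0r. Qed.
Lemma nablaZl f X Z : nabla (f *: X) Z = f *: nabla X Z.
Proof. by case: LC => /(_ Z f X 0); rewrite nabla0l !addr0. Qed.
Lemma nablaNl X Z : nabla (- X) Z = - nabla X Z.
Proof. by rewrite -scaleN1r nablaZl scaleN1r. Qed.
Lemma nablaDr X Y Z : nabla X (Y + Z) = nabla X Y + nabla X Z.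
Proof. by case: LC => _ /(_ X 1 Y Z); rewrite vder1 scale0r add0r !scale1r. Qed.
Lemma nabla0r X : nabla X 0 = 0.
Proof. by apply: (addIr (nabla X 0)); rewrite -nablaDr !add0r. Qed.
Lemma nablaZr X f Y : nabla X (f *: Y) = X f *: Y + f *: nabla X Y.
Proof. by case: LC => _ /(_ X f Y 0); rewrite nabla0r !addr0. Qed.
Lemma nablaNr X Z : nabla X (- Z) = - nabla X Z.
Proof. by apply/eqP; rewrite -addr_eq0 -nablaDr addNr nabla0r. Qed.

Definition nablaE := (nablaDr, nablaDl, nablaZr, nablaZl, nablaNr,
  nablaNl, nabla0r, nabla0l).

Lemma torsion_free X Y : bracket X Y = nabla X Y - nabla Y X.
Proof. by case: LC => _ _ ->. Qed.

Lemma deriv_metric X Y Z : X (g Y Z) = g (nabla X Y) Z + g Y (nabla X Z).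
Proof. by case: LC => _ _ _; apply. Qed.

Local Notation cov := (cov nabla).

Lemma covE (F : V -> V) X Y : cov F X Y = nabla X (F Y) - F (nabla X Y).
Proof. by rewrite unlock. Qed.

Lemma cov_adjoint (F F' : V -> V) X Y Z :
  (forall X Y, g (F X) Y = g X (F' Y)) -> g (cov F X Y) Z = g Y (cov F' X Z).
Proof.
move=> adj; have := congr1 X (adj Y Z); rewrite !deriv_metric !covE !metricE.
rewrite !adj => e; apply: smooth_funP => p.
by have := pt_eq p e; rewrite !smooth_evE; lra.
Qed.

Lemma cov_skew (F : V -> V) X Y Z :
  (forall X Y, g (F X) Y = - g X (F Y)) -> g (cov F X Y) Z = - g Y (cov F X Z).
Proof.
move=> skew; have adj A B : g (F A) B = g A (- F B) by rewrite skew metricE.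
by rewrite (cov_adjoint _ _ _ adj) !covE nablaE !metricE; fun_ring.
Qed.

Lemma cov_comp (F : {linear V -> V}) (F' : V -> V) X Y :
  cov (F \o F') X Y = cov F X (F' Y) + F (cov F' X Y).
Proof. by rewrite !covE /= linearB addrA subrK. Qed.

Lemma cov_addl (F : {linear V -> V}) X X' Y :
  cov F (X + X') Y = cov F X Y + cov F X' Y.
Proof. rewrite !covE !nablaE !(endoE F); vec_ring. Qed.
Lemma cov_scalel (F : {linear V -> V}) f X Y :
  cov F (f *: X) Y = f *: cov F X Y.
Proof. rewrite !covE !nablaE !(endoE F); vec_ring. Qed.
Lemma cov_addr (F : {linear V -> V}) X Y Y' :
  cov F X (Y + Y') = cov F X Y + cov F X Y'.
Proof. rewrite !covE !(nablaE, endoE F); vec_ring. Qed.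
Lemma cov_scaler (F : {linear V -> V}) f X Y :
  cov F X (f *: Y) = f *: cov F X Y.
Proof. rewrite !covE !(nablaE, endoE F); vec_ring. Qed.

End Metrics.

(** * Paracontact metric structures *)
Section ExteriorDerivative.
Context {R : realType} {m : nat} {M : manifold R m}.
Local Notation C := (smooth_fun M).
Local Notation V := (vfield M).
Context (eta : {scalar V}).
Implicit Types X Y Z : V.

Lemma ext_dC X Y : ext_d eta X Y = - ext_d eta Y X.
Proof.
have bC : bracket X Y = - bracket Y X by vec_ring.
by rewrite /ext_d bC linearN; fun_ring.
Qed.

Lemma ext_d_closed X Y Z :
  X (ext_d eta Y Z) - ext_d eta (bracket X Y) Z +
  (Y (ext_d eta Z X) - ext_d eta (bracket Y Z) X) +
  (Z (ext_d eta X Y) - ext_d eta (bracket Z X) Y) = 0.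
Proof.
have := congr1 eta (jacobi X Y Z); rewrite !linearD linear0 /= => J.
rewrite /ext_d !vderE !bracketE; apply: smooth_funP => p.
have := pt_eq p J; rewrite !smooth_evE; lra.
Qed.

End ExteriorDerivative.

Section ParacontactMetric.
Context {R : realType} {m : nat} {M : manifold R m}.
Local Notation C := (smooth_fun M).
Local Notation V := (vfield M).
Context (phi : {linear V -> V}) (xi : V) (eta : {scalar V}).
Context (g : V -> V -> C) (nabla : V -> V -> V).
Implicit Types X Y Z : V.
Hypotheses (eta_xi : eta xi = 1).
Hypothesis phi2 : forall X, phi (phi X) = X - eta X *: xi.
Hypotheses (gP : sym_bilinear g).
Hypothesis gnd : forall p X, (forall Y, g X Y p = 0) -> eq_at p X 0.
Hypothesis g_phi : forall X Y, g (phi X) (phi Y) = - g X Y + eta X * eta Y.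
Hypothesis deta : forall X Y, ext_d eta X Y = g X (phi Y).
Hypothesis LC : levi_civita g nabla.

Let gE := (metricE gP).
Let nE := (nablaE LC).

Lemma metric_inj X Y : (forall Z, g X Z = g Y Z) -> X = Y.
Proof.
move=> XY; apply: vfieldP => f; apply: smooth_funP => p.
have /(_ f) : eq_at p (X - Y) 0.
  by apply: gnd => Z; rewrite !gE XY !smooth_evE subrr.
by rewrite !vfieldE !smooth_evE => /eqP; rewrite subr_eq0 => /eqP.
Qed.

(** phi^2 xi = 0 and phi^2 (phi xi) = phi xi - eta (phi xi) xi show that phi xi
    is a multiple of xi, with a square-zero factor. *)
Lemma phi_xi : phi xi = 0.
Proof.
have p2 : phi (phi xi) = 0 by rewrite phi2 eta_xi scale1r subrr.
have := phi2 (phi xi); rewrite p2 linear0 => /esym/eqP; rewrite subr_eq0.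
set a := eta _ => /eqP e; have := p2; rewrite e linearZ /= e scalerA.
move=> /(congr1 eta); rewrite linearZ /= eta_xi mulr1 linear0 => a2.
suff -> : a = 0 by rewrite scale0r.
apply: smooth_funP => p; have := pt_eq p a2.
by rewrite !smooth_evE => /eqP; rewrite mulf_eq0 orbb => /eqP.
Qed.

Lemma eta_phi X : eta (phi X) = 0.
Proof.
have := phi2 (phi X); rewrite (phi2 X) linearB linearZ /= phi_xi scaler0 subr0.
move=> /eqP; rewrite eq_sym -subr_eq0 addrAC subrr add0r oppr_eq0 => /eqP.
by move=> /(congr1 eta); rewrite linearZ /= eta_xi mulr1 linear0.
Qed.

Lemma eta_metric X : eta X = g X xi.
Proof.
have := g_phi X xi; rewrite phi_xi gE eta_xi mulr1 => /esym/eqP.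
by rewrite addrC subr_eq0 => /eqP.
Qed.

Lemma phi_skew X Y : g (phi X) Y = - g X (phi Y).
Proof. by rewrite (metricC gP) -!deta ext_dC. Qed.

(** nabla xi without its skew part - phi; it turns out to be phi h. *)
Definition para_shape X : V := nabla X xi + phi X.
Local Notation S := para_shape.

Lemma para_shape_is_linear : linear S.
Proof. move=> f X Y; rewrite /para_shape !(nE, endoE phi); vec_ring. Qed.

Lemma para_shape_sym X Y : g (S X) Y = g X (S Y).
Proof.
have := deta X Y; rewrite /ext_d !eta_metric !(deriv_metric LC) (torsion_free LC).
rewrite /para_shape !gE phi_skew (metricC gP (nabla X xi)) => e.
apply: smooth_funP => p; have := pt_eq p e.
by rewrite !smooth_evE; lra.
Qed.

Lemma eta_nabla_xi X : eta (nabla X xi) = 0.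
Proof.
have := deriv_metric LC X xi xi; rewrite -eta_metric eta_xi vder1.
rewrite (metricC gP xi) -eta_metric => e.
by apply: smooth_funP => p; have := pt_eq p e;
  rewrite !smooth_evE; lra.
Qed.

Lemma eta_para_shape X : eta (S X) = 0.
Proof. by rewrite /para_shape linearD /= eta_phi eta_nabla_xi addr0. Qed.

Lemma para_shape_xi : S xi = 0.
Proof.
apply: metric_inj => Z; rewrite para_shape_sym (metricC gP) -eta_metric.
by rewrite eta_para_shape gE.
Qed.

(** The covariant form of d (d eta) = 0. *)
Lemma nabla_phi_closed X Y Z : g (cov nabla phi X Y) Z +
  g (cov nabla phi Y Z) X + g (cov nabla phi Z X) Y = 0.
Proof.
rewrite !(cov_skew gP LC _ _ _ phi_skew) !covE !gE; have := ext_d_closed eta X Y Z.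
rewrite !deta !(torsion_free LC) !(deriv_metric LC) !gE => e.
apply: smooth_funP => p; have := pt_eq p e.
have h A B D : g A (phi (nabla B D)) p = - g (nabla B D) (phi A) p.
  by rewrite (metricC gP) phi_skew smooth_evE.
rewrite !smooth_evE !h; lra.
Qed.

End ParacontactMetric.

(** * Testing tensors on eigenvectors of phi *)
Section TrilinearVanishing.
Context {R : realType} {m : nat} {M : manifold R m}.
Local Notation C := (smooth_fun M).
Local Notation V := (vfield M).
Context (phi : {linear V -> V}) (xi : V) (eta : {scalar V}).
Implicit Types X Y Z : V.
Hypothesis phi2 : forall X, phi (phi X) = X - eta X *: xi.
Hypothesis eta_phi : forall X, eta (phi X) = 0.

Definition is_sign (s : R) := s = 1 \/ s = -1.

Lemma is_signN s : is_sign s -> is_sign (- s).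
Proof. by case=> ->; rewrite ?opprK; [right|left]. Qed.

Lemma sign_eigen_decomp X : exists Xp Xm, [/\ eigen_distr phi eta 1 Xp,
  eigen_distr phi eta (- 1) Xm & X = Xp + Xm + eta X *: xi].
Proof.
have phi3 : phi (phi (phi X)) = phi X by rewrite phi2 eta_phi scale0r subr0.
exists ((2^-1)%:S *: (phi (phi X) + phi X)).
exists ((2^-1)%:S *: (phi (phi X) - phi X)).
split; first 2 last.
- by rewrite phi2; vec_field.
- split; rewrite !(formE eta, endoE phi) ?eta_phi; first fun_ring.
  by rewrite phi3; vec_ring.
- split; rewrite !(formE eta, endoE phi) ?eta_phi; first fun_ring.
  by rewrite phi3; vec_ring.
Qed.

(** Every field splits into a component in each eigendistribution and a multiple
    of xi, so a tensor of degree three is determined by these arguments. *)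
Lemma trilinear_eq0 (F : V -> V -> V -> C) :
  (forall f X X' Y Z, F (f *: X + X') Y Z = f * F X Y Z + F X' Y Z) ->
  (forall f X Y Y' Z, F X (f *: Y + Y') Z = f * F X Y Z + F X Y' Z) ->
  (forall f X Y Z Z', F X Y (f *: Z + Z') = f * F X Y Z + F X Y Z') ->
  (forall Y Z, F xi Y Z = 0) -> (forall X Z, F X xi Z = 0) ->
  (forall X Y, F X Y xi = 0) ->
  (forall a b c X Y Z, is_sign a -> is_sign b -> is_sign c ->
    eigen_distr phi eta a X -> eigen_distr phi eta b Y ->
    eigen_distr phi eta c Z -> F X Y Z = 0) ->
  forall X Y Z, F X Y Z = 0.
Proof.
move=> F1 F2 F3 Fx1 Fx2 Fx3 F0 X Y Z.
have s1 : is_sign 1 by left.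
have sN1 : is_sign (- 1) by right.
have [Xp [Xm [Xp1 Xm1 ->]]] := sign_eigen_decomp X.
have [Yp [Ym [Yp1 Ym1 ->]]] := sign_eigen_decomp Y.
have [Zp [Zm [Zp1 Zm1 ->]]] := sign_eigen_decomp Z.
have e A B c : A + B + c *: xi = c *: xi + (1 *: A + B).
  by vec_ring.
rewrite !e !(F1, F2, F3) !(Fx1, Fx2, Fx3).
rewrite (F0 _ _ _ _ _ _ s1 s1 s1) // (F0 _ _ _ _ _ _ s1 s1 sN1) //.
rewrite (F0 _ _ _ _ _ _ s1 sN1 s1) // (F0 _ _ _ _ _ _ s1 sN1 sN1) //.
rewrite (F0 _ _ _ _ _ _ sN1 s1 s1) // (F0 _ _ _ _ _ _ sN1 s1 sN1) //.
rewrite (F0 _ _ _ _ _ _ sN1 sN1 s1) // (F0 _ _ _ _ _ _ sN1 sN1 sN1) //.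
by rewrite !(mulr0, addr0).
Qed.

End TrilinearVanishing.

(** * The nullity condition *)

(** What the sequel uses of a paracontact metric structure, with [S] in the role
    of nabla xi + phi. *)
Record paracontact_calculus (R : realType) (m : nat) (M : manifold R m)
    (phi S : {linear vfield M -> vfield M}) (xi : vfield M)
    (eta : {scalar vfield M}) (g : vfield M -> vfield M -> smooth_fun M)
    (nabla : vfield M -> vfield M -> vfield M) : Prop := {
  pc_metric : sym_bilinear g;
  pc_inj : forall X Y, (forall Z, g X Z = g Y Z) -> X = Y;
  pc_LC : levi_civita g nabla;
  pc_eta_xi : eta xi = 1;
  pc_phi2 : forall X, phi (phi X) = X - eta X *: xi;
  pc_phi_xi : phi xi = 0;
  pc_eta_phi : forall X, eta (phi X) = 0;
  pc_eta : forall X, eta X = g X xi;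
  pc_phi_skew : forall X Y, g (phi X) Y = - g X (phi Y);
  pc_nabla_xi : forall X, nabla X xi = - phi X + S X;
  pc_S_sym : forall X Y, g (S X) Y = g X (S Y);
  pc_eta_S : forall X, eta (S X) = 0;
  pc_S_xi : S xi = 0;
  pc_closed : forall X Y Z, g (cov nabla phi X Y) Z + g (cov nabla phi Y Z) X +
    g (cov nabla phi Z X) Y = 0 }.

Section Nullity.
Context {R : realType} {m : nat} {M : manifold R m}.
Local Notation C := (smooth_fun M).
Local Notation V := (vfield M).
Context (phi S : {linear V -> V}) (xi : V) (eta : {scalar V}).
Context (g : V -> V -> C) (nabla : V -> V -> V).
Implicit Types X Y Z W : V.
Hypothesis PC : paracontact_calculus phi S xi eta g nabla.
Local Notation T := (cov nabla phi).
Local Notation covS := (cov nabla S).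

Let gP := pc_metric PC.
Let gE := metricE gP.
Let gC := metricC gP.
Let LC := pc_LC PC.
Let nE := nablaE LC.
Let eta_xi := pc_eta_xi PC.
Let phi2 := pc_phi2 PC.
Let phi_xi := pc_phi_xi PC.
Let eta_phi := pc_eta_phi PC.
Let phi_skew := pc_phi_skew PC.
Let nabla_xi := pc_nabla_xi PC.
Let S_sym := pc_S_sym PC.
Let eta_S := pc_eta_S PC.
Let S_xi := pc_S_xi PC.

Let phi3 X : phi (phi (phi X)) = phi X.
Proof. by rewrite phi2 eta_phi scale0r subr0. Qed.

Let phi2S X : phi (phi (S X)) = S X.
Proof. by rewrite phi2 eta_S scale0r subr0. Qed.

Let Sphi2 X : S (phi (phi X)) = S X.
Proof. by rewrite phi2 !(endoE S) S_xi scaler0 subr0. Qed.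

Let g_xi X : g xi X = eta X.
Proof. by rewrite gC (pc_eta PC). Qed.

Lemma nabla_phi_skew X Y Z : g (T X Y) Z = - g Y (T X Z).
Proof. exact: (cov_skew gP LC X Y Z phi_skew). Qed.

Lemma nabla_S_sym X Y Z : g (covS X Y) Z = g Y (covS X Z).
Proof. exact: (cov_adjoint gP LC X Y Z S_sym). Qed.

(** The derivative of phi^2 = I - eta xi. *)
Lemma nabla_phi_comp X Y :
  T X (phi Y) + phi (T X Y) = - g (nabla X xi) Y *: xi - eta Y *: nabla X xi.
Proof.
rewrite -(cov_comp nabla) !covE /= !phi2 !nE !(pc_eta PC) !(deriv_metric LC).
rewrite (gC Y (nabla X xi)); vec_ring.
Qed.

Lemma nabla_phi_at_xi X : T X xi = phi (phi X) - phi (S X).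
Proof.
rewrite !covE phi_xi nE nabla_xi !(endoE phi); vec_ring.
Qed.

Let phi_along_xi X : T xi X = - phi (S X) - S (phi X).
Proof.
apply: (pc_inj PC) => Z; rewrite (gC (- _ - _)) !gE.
have := pc_closed PC xi X Z.
rewrite (nabla_phi_skew X Z xi) !nabla_phi_at_xi !gE !phi_skew S_sym => e.
by apply: smooth_funP => p; have := pt_eq p e; rewrite !smooth_evE; lra.
Qed.

(** nabla_xi phi = - phi S - S phi by closedness; it anticommutes with phi, since
    nabla_xi xi = 0.  Together these two facts force phi S phi = - S. *)
Lemma S_phi X : S (phi X) = - phi (S X).
Proof.
have e : phi (S (phi X)) = - S X.
  have := nabla_phi_comp xi X; rewrite !phi_along_xi nabla_xi phi_xi S_xi oppr0 add0r.
  rewrite !gE oppr0 scale0r scaler0 subr0 Sphi2.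
  rewrite !(endoE phi) phi2S => e.
  apply: vfieldP => f; apply: smooth_funP => p.
  have := pt_eq p (congr1 (fun X : V => X f) e).
  by rewrite !vfieldE !smooth_evE; lra.
by rewrite -(phi2S (phi X)) e (endoE phi).
Qed.

Lemma nabla_phi_along_xi X : T xi X = 0.
Proof. by rewrite phi_along_xi S_phi opprK addNr. Qed.

Lemma h_tensorE X : h_tensor xi phi X = phi (S X).
Proof.
rewrite /h_tensor /lie_endo !(torsion_free LC) !nabla_xi.
have := nabla_phi_along_xi X; rewrite !covE => /eqP; rewrite subr_eq0 => /eqP ->.
rewrite S_phi !(endoE phi, endoE S); vec_field.
Qed.

(** The derivative of S phi = - phi S. *)
Lemma nabla_S_anticomm X Y :
  covS X (phi Y) + phi (covS X Y) = - S (T X Y) - T X (S Y).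
Proof.
have e : nabla X (S (phi Y)) = - nabla X (phi (S Y)) by rewrite S_phi nE.
by rewrite !covE !(endoE phi, endoE S) e S_phi; vec_ring.
Qed.

Lemma curvature_xi X Y :
  curvature nabla X Y xi = covS X Y - T X Y - (covS Y X - T Y X).
Proof.
rewrite /curvature !nabla_xi (torsion_free LC) !nE !covE.
by rewrite !(endoE phi, endoE S); vec_ring.
Qed.

Context (k mu : R).
Hypothesis curv : forall X Y, curvature nabla X Y xi =
  k%:S *: (eta Y *: X - eta X *: Y) +
  mu%:S *: (eta Y *: h_tensor xi phi X - eta X *: h_tensor xi phi Y).

Lemma codazzi X Y : covS X Y - T X Y - (covS Y X - T Y X) =
  k%:S *: (eta Y *: X - eta X *: Y) +
  mu%:S *: (eta Y *: phi (S X) - eta X *: phi (S Y)).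
Proof. by rewrite -curvature_xi curv !h_tensorE. Qed.

Lemma nabla_S_at_xi X : covS X xi = S (phi X) - S (S X).
Proof.
rewrite !covE S_xi nE nabla_xi !(endoE phi, endoE S); vec_ring.
Qed.

(* R (xi, X) xi, computed from nabla xi on one side and from the nullity
   condition on the other. *)
Let jacobi_xi X : covS xi X + S (S X) =
  - (1 + k)%:S *: phi (phi X) - mu%:S *: phi (S X).
Proof.
have := codazzi xi X.
rewrite nabla_phi_along_xi nabla_phi_at_xi nabla_S_at_xi eta_xi S_xi.
rewrite !(endoE phi) S_phi => e.
apply: vfieldP => f; apply: smooth_funP => p.
have := pt_eq p (congr1 (fun X : V => X f) e).
by rewrite phi2 !vfieldE !smooth_evE; lra.
Qed.

(* The sum of phi (jacobi_xi X) and jacobi_xi (phi X): nabla_xi S and phi S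
   anticommute with phi, hence drop out. *)
Let S2phi X : S (S (phi X)) = - (1 + k)%:S *: phi X.
Proof.
have e1 := jacobi_xi (phi X).
have e2 := congr1 phi (jacobi_xi X).
have e3 := nabla_S_anticomm xi X.
rewrite !nabla_phi_along_xi !(endoE S) oppr0 addr0 in e3.
rewrite ?(S_phi, endoE phi, endoE S, phi3) in e1 e2 *.
apply: vfieldP => f; apply: smooth_funP => p.
have := pt_eq p (congr1 (fun X : V => X f) e1).
have := pt_eq p (congr1 (fun X : V => X f) e2).
have := pt_eq p (congr1 (fun X : V => X f) e3).
by rewrite !vfieldE !smooth_evE; lra.
Qed.

Lemma S2 X : S (S X) = - (1 + k)%:S *: phi (phi X).
Proof. by rewrite -S2phi Sphi2. Qed.

Lemma nabla_S_along_xi X : covS xi X = - mu%:S *: phi (S X).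
Proof.
have e := jacobi_xi X; rewrite S2 in e; vec_lra e.
Qed.

Hypothesis k_neq : k != - 1.
Local Notation D := (eigen_distr phi eta).

Let k1 : 1 + k != 0.
Proof. by rewrite addrC -[1]opprK subr_eq0. Qed.

(** S exchanges the two eigendistributions, and is onto as S^2 is a nonzero
    multiple of the identity on ker eta. *)
Lemma S_eigen s X : D s X -> D (- s) (S X).
Proof.
move=> [eX pX]; split=> //.
have := S_phi X; rewrite pX linearZ /= => e.
by rewrite -[phi _]opprK -e; vec_ring.
Qed.

Lemma S_eigen_surj s W : D s W -> exists2 X, D (- s) X & S X = W.
Proof.
move=> /[dup] sW [eW pW]; exists (- ((1 + k)^-1)%:S *: S W).
  have [_ pSW] := S_eigen sW; split; rewrite linearZ /= ?eta_S ?mulr0 //.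
  by rewrite pSW; vec_ring.
by rewrite linearZ /= S2 phi2 eW; vec_field.
Qed.

(** On ker eta, nabla_X phi anticommutes with the skew phi up to multiples of
    xi. *)
Lemma nabla_phi_opposite s X Y Z : is_sign s -> D s Y -> D (- s) Z ->
  g (T X Y) Z = 0.
Proof.
move=> s1 [eY pY] [eZ pZ]; have := congr1 (g^~ Z) (nabla_phi_comp X Y).
rewrite /= pY (cov_scaler LC) !gE phi_skew pZ gE g_xi eZ eY => e.
apply: smooth_funP => p; have := pt_eq p e.
by rewrite !smooth_evE; case: s1 => ->; lra.
Qed.

Lemma nabla_phi_mixed s X Y Z : is_sign s -> D (- s) X -> D s Y -> D s Z ->
  g (T X Y) Z = 0.
Proof.
move=> s1 DX DY DZ; have := pc_closed PC X Y Z.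
rewrite (nabla_phi_opposite _ s1 DZ DX) (nabla_phi_skew Z) (gC X).
by rewrite (nabla_phi_opposite _ s1 DY DX) oppr0 !addr0.
Qed.

(** R (X, Y) xi vanishes on ker eta; closedness merges the two derivatives of phi
    into one. *)
Lemma codazzi_horizontal X Y Z : eta X = 0 -> eta Y = 0 ->
  g (T Z X) Y = g (covS Y X) Z - g (covS X Y) Z.
Proof.
move=> eX eY; have := congr1 (g^~ Z) (codazzi X Y); have := pc_closed PC X Y Z.
rewrite /= !gE eX eY (nabla_phi_skew Y Z) (gC Z) => e1 e2.
apply: smooth_funP => p; have := pt_eq p e1; have := pt_eq p e2.
by rewrite !smooth_evE; lra.
Qed.

(** Derivative of S phi = - phi S, evaluated between opposite eigenvectors; the
    term in nabla_Y phi (S Z) vanishes by nabla_phi_mixed. *)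
Lemma nabla_S_mixed s X Y Z : is_sign s -> D s Y -> D s Z -> D (- s) X ->
  (2 * s)%:S * g (covS Y Z) X = - g (T Y Z) (S X).
Proof.
move=> s1 DY DZ DX; have [eZ pZ] := DZ; have [eX pX] := DX.
have DSZ := S_eigen DZ; have sN1 := is_signN s1.
have := congr1 (g^~ X) (nabla_S_anticomm Y Z).
rewrite /= pZ (cov_scaler LC) !gE phi_skew pX gE S_sym.
rewrite (nabla_phi_mixed sN1 _ DSZ DX) ?opprK // => e.
apply: smooth_funP => p; have := pt_eq p e.
by rewrite !smooth_evE; lra.
Qed.

(** Write W = S X.  By codazzi_horizontal, g (nabla_Z S Y) X is symmetric in Y
    and Z, hence so is g (nabla_Y phi Z) W by nabla_S_mixed; closedness turns
    this symmetry into the vanishing of g (nabla_W phi Z) Y. *)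
Lemma nabla_phi_same s W Y Z : is_sign s -> D s W -> D s Y -> D s Z ->
  g (T W Y) Z = 0.
Proof.
move=> s1 DW DY DZ; have [X DX WE] := S_eigen_surj DW.
have [[eY _] [eZ _]] := (DY, DZ).
have := codazzi_horizontal X eY eZ; rewrite (nabla_phi_mixed s1 DX DY DZ) => e.
have := pc_closed PC W Y Z; rewrite (nabla_phi_skew Z W).
rewrite -WE => e0.
have e1 := nabla_S_mixed s1 DY DZ DX; have e2 := nabla_S_mixed s1 DZ DY DX.
have c1 : g (S X) (T Z Y) = g (T Z Y) (S X) by rewrite gC.
apply: smooth_funP => p; have := pt_eq p e; have := pt_eq p e0.
have := pt_eq p e1; have := pt_eq p e2; have := pt_eq p c1.
by rewrite !smooth_evE; case: s1 => ->; lra.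
Qed.

Lemma is_sign_cases (s t : R) : is_sign s -> is_sign t -> t = s \/ t = - s.
Proof. by case=> -> [] ->; rewrite ?opprK; auto. Qed.

Lemma nabla_phi_horizontal a b c X Y Z : is_sign a -> is_sign b -> is_sign c ->
  D a X -> D b Y -> D c Z -> g (T X Y) Z = 0.
Proof.
move=> a1 b1 c1 DX DY DZ.
case: (is_sign_cases b1 c1) DZ => -> DZ; last exact: nabla_phi_opposite b1 DY DZ.
case: (is_sign_cases b1 a1) DX => -> DX; first exact: nabla_phi_same b1 DX DY DZ.
exact: nabla_phi_mixed b1 DX DY DZ.
Qed.

(** With the horizontal part of nabla phi gone, codazzi_horizontal makes
    g (nabla_X S Y) Z totally symmetric.  It vanishes on triples of mixed signs by
    nabla_S_mixed; differentiating S^2 = - (1 + k) phi^2 moves S between the last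
    two arguments, and so reduces equal signs to mixed ones. *)
Lemma nabla_S_horizontal a b c X Y Z : is_sign a -> is_sign b -> is_sign c ->
  D a X -> D b Y -> D c Z -> g (covS X Y) Z = 0.
Proof.
move: a b c X Y Z; have swap12 a b c X Y Z : is_sign a -> is_sign b -> is_sign c ->
    D a X -> D b Y -> D c Z -> g (covS X Y) Z = g (covS Y X) Z.
  move=> a1 b1 c1 DX DY DZ; have [[eX _] [eY _]] := (DX, DY).
  have := codazzi_horizontal Z eX eY; rewrite (nabla_phi_horizontal c1 a1 b1 DZ DX DY).
  by move=> /esym/eqP; rewrite subr_eq0 => /eqP.
have mixed s X Y Z : is_sign s -> D s X -> D s Y -> D (- s) Z ->
    g (covS X Y) Z = 0.
  move=> s1 DX DY DZ; have DSZ := S_eigen DZ; rewrite opprK in DSZ.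
  have := nabla_S_mixed s1 DX DY DZ; rewrite (nabla_phi_same s1 DX DY DSZ) => e.
  apply: smooth_funP => p; have := pt_eq p e.
  by rewrite !smooth_evE; case: s1 => ->; lra.
have mixed' s X Y Z : is_sign s -> D s X -> D (- s) Y -> D s Z ->
    g (covS X Y) Z = 0.
  by move=> s1 DX DY DZ; rewrite nabla_S_sym gC; apply: mixed DX DZ DY.
have pure s X Y Z : is_sign s -> D s X -> D s Y -> D s Z ->
    g (covS X Y) Z = 0.
  move=> s1 DX DY DZ; have [Z' DZ' ZE] := S_eigen_surj DZ.
  have [[eY _] [eZ' _]] := (DY, DZ').
  have sN := is_signN s1; have DSY := S_eigen DY.
  have := cov_comp nabla S S X Y; rewrite {1}covE /= !S2 !phi2 eY scale0r subr0.
  rewrite !nE vderN vder_cst => /(congr1 (g^~ Z')); rewrite /= !gE g_xi eZ' S_sym ZE.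
  rewrite (swap12 _ _ _ _ _ _ s1 sN sN DX DSY DZ').
  rewrite (mixed' _ _ _ _ sN DSY _ DZ') ?opprK // => e.
  by fun_lra e.
move=> a b c X Y Z a1 b1 c1 DX DY DZ.
case: (is_sign_cases a1 b1) DY => -> DY.
  by case: (is_sign_cases a1 c1) DZ => -> DZ; [exact: pure DX DY DZ|
    exact: mixed DX DY DZ].
case: (is_sign_cases a1 c1) DZ => -> DZ; first exact: mixed' DX DY DZ.
rewrite (swap12 _ _ _ _ _ _ a1 (is_signN a1) (is_signN a1) DX DY DZ).
by apply: (mixed' (- a)); rewrite ?opprK //; exact: is_signN.
Qed.

(** The remaining components are prescribed by nabla_xi phi = 0 and
    (nabla_X phi) xi = - phi (nabla_X xi). *)
Lemma nabla_phi_formula X Y : T X Y =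
  eta Y *: (phi (phi X) - phi (S X)) - g (phi (phi X) - phi (S X)) Y *: xi.
Proof.
apply: (pc_inj PC) => Z; apply/eqP; rewrite -subr_eq0; apply/eqP.
pose F X Y Z : C := g (T X Y) Z - g (eta Y *: (phi (phi X) - phi (S X)) -
  g (phi (phi X) - phi (S X)) Y *: xi) Z.
have lin := (gE, cov_addl LC, cov_addr LC, cov_scalel LC, cov_scaler LC, formE eta,
  endoE phi, endoE S).
have g_xi_r A : g A xi = eta A by rewrite gC g_xi.
apply: (trilinear_eq0 phi2 eta_phi (F := F)) => {X Y Z}; rewrite /F.
- by move=> f X X' Y Z; rewrite !lin; fun_ring.
- by move=> f X Y Y' Z; rewrite !lin; fun_ring.
- by move=> f X Y Z Z'; rewrite !lin; fun_ring.
- by move=> Y Z; rewrite nabla_phi_along_xi phi_xi S_xi !lin; fun_ring.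
- move=> X Z; rewrite nabla_phi_at_xi eta_xi !lin !g_xi_r g_xi !eta_phi; fun_ring.
- move=> X Y; rewrite nabla_phi_skew nabla_phi_at_xi !lin !g_xi_r !eta_phi eta_xi.
  by rewrite !(gC Y); fun_ring.
move=> a b c X Y Z a1 b1 c1 DX DY DZ.
rewrite (nabla_phi_horizontal a1 b1 c1 DX DY DZ) !gE g_xi.
by case: DY => ->; case: DZ => -> _ _; fun_ring.
Qed.

(** The remaining components are prescribed by nabla_xi S = - mu phi S and
    (nabla_X S) xi = - S (nabla_X xi). *)
Lemma nabla_S_formula X Y : covS X Y =
  - (mu%:S * eta X) *: phi (S Y)
  + eta Y *: ((1 + k)%:S *: phi (phi X) - phi (S X))
  + g ((1 + k)%:S *: phi (phi X) - phi (S X)) Y *: xi.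
Proof.
apply: (pc_inj PC) => Z; apply/eqP; rewrite -subr_eq0; apply/eqP.
pose F X Y Z : C := g (covS X Y) Z - g (- (mu%:S * eta X) *: phi (S Y)
  + eta Y *: ((1 + k)%:S *: phi (phi X) - phi (S X))
  + g ((1 + k)%:S *: phi (phi X) - phi (S X)) Y *: xi) Z.
have lin := (gE, cov_addl LC, cov_addr LC, cov_scalel LC, cov_scaler LC, formE eta,
  endoE phi, endoE S).
have g_xi_r A : g A xi = eta A by rewrite gC g_xi.
apply: (trilinear_eq0 phi2 eta_phi (F := F)) => {X Y Z}; rewrite /F.
- by move=> f X X' Y Z; rewrite !lin; fun_ring.
- by move=> f X Y Y' Z; rewrite !lin; fun_ring.
- by move=> f X Y Z Z'; rewrite !lin; fun_ring.
- by move=> Y Z; rewrite nabla_S_along_xi phi_xi S_xi eta_xi !lin; fun_ring.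
- move=> X Z; rewrite nabla_S_at_xi S_phi S2 eta_xi S_xi !lin !g_xi_r !g_xi !eta_phi.
  by fun_ring.
- move=> X Y; rewrite nabla_S_sym nabla_S_at_xi S_phi S2 !lin !g_xi_r !eta_phi eta_xi.
  by rewrite !(gC Y); fun_ring.
move=> a b c X Y Z a1 b1 c1 DX DY DZ.
rewrite (nabla_S_horizontal a1 b1 c1 DX DY DZ) !gE g_xi.
by case: DX DY DZ => -> _ [-> _] [-> _]; fun_ring.
Qed.

End Nullity.

(** * The contact metric and its connection *)

(** Equals - d eta (X, phib Y) + eta X eta Y for phib = c phi S, because
    phi^2 S = S.  Locked so that the rules for sums do not see through it. *)
HB.lock Definition contact_metric (R : realType) (m : nat) (M : manifold R m)
    (S : vfield M -> vfield M) (eta : vfield M -> smooth_fun M)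
    (g : vfield M -> vfield M -> smooth_fun M) (c : R) (X Y : vfield M) :
    smooth_fun M :=
  - (c%:S * g X (S Y)) + eta X * eta Y.

Section ContactSide.
Context {R : realType} {m : nat} {M : manifold R m}.
Local Notation C := (smooth_fun M).
Local Notation V := (vfield M).
Context (phi S : {linear V -> V}) (xi : V) (eta : {scalar V}).
Context (g : V -> V -> C) (nabla : V -> V -> V).
Context (k mu c : R).
Implicit Types X Y Z W : V.
Hypothesis PC : paracontact_calculus phi S xi eta g nabla.
Hypothesis curv : forall X Y, curvature nabla X Y xi =
  k%:S *: (eta Y *: X - eta X *: Y) +
  mu%:S *: (eta Y *: h_tensor xi phi X - eta X *: h_tensor xi phi Y).
Hypothesis c_neq0 : c != 0.
Hypothesis kE : k = - 1 - c^-1 * c^-1.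
Local Notation a := (1 - mu / 2).
Local Notation d := (c^-1).

Let k_neq : k != - 1.
Proof. by rewrite kE -subr_eq0 addrAC subrr add0r oppr_eq0 mulf_neq0 ?invr_eq0. Qed.

Let gP := pc_metric PC.
Let gE := metricE gP.
Let gC := metricC gP.
Let LC := pc_LC PC.
Let nE := nablaE LC.
Let eta_xi := pc_eta_xi PC.
Let phi2 := pc_phi2 PC.
Let phi_xi := pc_phi_xi PC.
Let eta_phi := pc_eta_phi PC.
Let phi_skew := pc_phi_skew PC.
Let S_sym := pc_S_sym PC.
Let eta_S := pc_eta_S PC.
Let S_xi := pc_S_xi PC.
Let S_phi := S_phi PC.

Let g_xi X : g xi X = eta X.
Proof. by rewrite gC (pc_eta PC). Qed.

Let g_xi_r X : g X xi = eta X.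
Proof. by rewrite (pc_eta PC). Qed.

Let S2 X : S (S X) = (d * d)%:S *: (X - eta X *: xi).
Proof. rewrite (S2 PC curv) phi2 kE; vec_ring. Qed.

(* Normal forms of words in phi and S: 1, phi, S or phi S, up to a scalar and to
   multiples of xi. *)
Let wordE := (endoE phi, endoE S, formE eta, phi2, S_phi, S2, phi_xi, S_xi,
  eta_phi, eta_S, eta_xi).

Let left_phi X Y : g X (phi Y) = - g (phi X) Y.
Proof. by rewrite phi_skew opprK. Qed.

Let left_S X Y : g X (S Y) = g (S X) Y.
Proof. by rewrite S_sym. Qed.

(* Inside g, these words move to the first argument; swapE then orders the two
   arguments. *)
Let innerE := (gE, left_phi, left_S, g_xi, g_xi_r).

Let swapE X Y : (g Y X = g X Y) * (g (phi Y) X = - g (phi X) Y) *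
  (g (S Y) X = g (S X) Y) * (g (phi (S Y)) X = g (phi (S X)) Y).
Proof.
split; [split; [split|]|].
- exact: gC.
- by rewrite gC left_phi.
- by rewrite gC left_S.
- by rewrite gC left_phi left_S S_phi !gE opprK.
Qed.

Let nabla_phiE X Y : nabla X (phi Y) = phi (nabla X Y) +
  (eta Y *: (X - eta X *: xi - phi (S X)) -
   g (X - eta X *: xi - phi (S X)) Y *: xi).
Proof.
have := nabla_phi_formula PC curv k_neq X Y.
by rewrite covE phi2 => /eqP; rewrite subr_eq addrC => /eqP.
Qed.

Let nabla_SE X Y : nabla X (S Y) = S (nabla X Y) +
  (- (mu%:S * eta X) *: phi (S Y)
   - eta Y *: ((d * d)%:S *: (X - eta X *: xi) + phi (S X))
   - g ((d * d)%:S *: (X - eta X *: xi) + phi (S X)) Y *: xi).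
Proof.
have := nabla_S_formula PC curv k_neq X Y.
rewrite covE => /eqP; rewrite subr_eq addrC => /eqP ->.
by rewrite phi2 kE !gE; vec_ring.
Qed.

Let nabla_xi X : nabla X xi = - phi X + S X := pc_nabla_xi PC X.

Let deriv_eta X Y : X (eta Y) = eta (nabla X Y) + g (- phi X + S X) Y.
Proof. by rewrite -!g_xi_r (deriv_metric LC) nabla_xi (gC Y). Qed.

Definition contact_tensor X : V := c%:S *: phi (S X).

(** Solution of the Koszul formula: the tensor D = contact_connection - nabla
    satisfies 2 gb (D X Y) Z = (nabla_X gb) Y Z + (nabla_Y gb) X Z -
    (nabla_Z gb) X Y, where the right-hand side is known from nabla_S_formula and
    gb = g (., G .) for the involution G = - c S + eta xi. *)
Definition contact_connection X Y : V := nabla X Y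
  + (2^-1)%:S *: (eta Y *: (mu%:S *: phi X - (2 * c)%:S *: phi (S X))
                + eta X *: (mu%:S *: phi Y - (2 * c)%:S *: phi (S Y)))
  + g ((a * c)%:S *: phi (S X) + d%:S *: (X - eta X *: xi) + S X) Y *: xi.
Local Notation phib := contact_tensor.
Local Notation gb := (contact_metric S eta g c).
Local Notation nablab := contact_connection.

Lemma contact_metricE X Y : gb X Y = - (c%:S * g X (S Y)) + eta X * eta Y.
Proof. by rewrite unlock. Qed.

Lemma contact_tensor_linear : linear phib.
Proof. by move=> f X Y; rewrite /phib !wordE; vec_ring. Qed.

Lemma contact_tensor2 X : phib (phib X) = - X + eta X *: xi.
Proof. by rewrite /phib !wordE; vec_field. Qed.

Lemma contact_tensor_xi : phib xi = 0.
Proof. by rewrite /phib !wordE scaler0. Qed.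

Lemma contact_metric_bilinear : sym_bilinear gb.
Proof.
split=> [X f Y Z|X Y]; rewrite !contact_metricE !(wordE, innerE); first fun_ring.
by rewrite !(swapE X Y); fun_ring.
Qed.

Lemma eta_contact_metric X : eta X = gb X xi.
Proof. by rewrite !contact_metricE !(wordE, innerE); fun_ring. Qed.

Lemma contact_metric_tensor X Y : gb (phib X) (phib Y) = gb X Y - eta X * eta Y.
Proof. by rewrite /phib !contact_metricE !(wordE, innerE); fun_field. Qed.

Lemma contact_metric_deta X Y : gb X (phib Y) = g X (phi Y).
Proof. by rewrite /phib !contact_metricE !(wordE, innerE); fun_field. Qed.

Lemma h_contact_tensor X :
  h_tensor xi phib X = (a * c)%:S *: S X + d%:S *: phi X.
Proof.
rewrite /h_tensor /lie_endo !(torsion_free LC) /phib !nE vder_cst !nabla_xi.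
by rewrite !(nabla_phiE, nabla_SE) !(wordE, innerE); vec_field.
Qed.

Let contact_metric_connection X Y Z : gb (nablab X Y) Z = gb (nabla X Y) Z
  + (2^-1)%:S *
    (eta Y * ((c * mu)%:S * g (phi (S X)) Z - 2%:S * g (phi X) Z)
     + eta X * ((c * mu)%:S * g (phi (S Y)) Z - 2%:S * g (phi Y) Z))
  + eta Z * ((a * c)%:S * g (phi (S X)) Y + d%:S * (g X Y - eta X * eta Y)
             + g (S X) Y).
Proof.
by rewrite /nablab !contact_metricE !(gE, left_S) !wordE !innerE; fun_field.
Qed.

Let deriv_contact_metric X Y Z : X (gb Y Z) =
  gb (nabla X Y) Z + gb Y (nabla X Z)
  + (c * mu)%:S * (eta X * g (phi (S Y)) Z)
  + eta Z * (d%:S * (g X Y - eta X * eta Y) + c%:S * g (phi (S X)) Y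
             + g (S X) Y - g (phi X) Y)
  + eta Y * (d%:S * (g X Z - eta X * eta Z) + c%:S * g (phi (S X)) Z
             + g (S X) Z - g (phi X) Z).
Proof.
rewrite !contact_metricE !vderE (deriv_metric LC) !deriv_eta nabla_SE.
by rewrite !(S_phi, endoE phi, innerE) !(swapE X Y); fun_field.
Qed.

Lemma contact_connection_LC : levi_civita gb nablab.
Proof.
split.
- by move=> Y f X X'; rewrite /nablab !nE !(endoE phi, endoE S, formE eta, gE);
    vec_ring.
- by move=> X f Y Z; rewrite /nablab !nE !(endoE phi, endoE S, formE eta, gE);
    vec_ring.
- move=> X Y; rewrite (torsion_free LC) /nablab !innerE !(swapE X Y); vec_ring.
move=> X Y Z; rewrite deriv_contact_metric contact_metric_connection.
rewrite !(metricC contact_metric_bilinear Y) contact_metric_connection.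
rewrite !(swapE Y Z); fun_field.
Qed.

Lemma contact_connection_xi X :
  nablab X xi = - a%:S *: phi X + S X - c%:S *: phi (S X).
Proof.
rewrite /nablab nabla_xi !(wordE, innerE); vec_field.
Qed.

Let nabla_phiSE X Y : nabla X (phi (S Y)) = phi (S (nabla X Y)) +
  (- (mu%:S * eta X) *: S Y - eta Y *: ((d * d)%:S *: phi X + S X)
   - g ((d * d)%:S *: phi X + S X) Y *: xi).
Proof.
rewrite nabla_phiE nabla_SE !(wordE, innerE); vec_ring.
Qed.

(* nabla xi for the new connection, by contact_connection_xi. *)
Local Notation A Y := (- a%:S *: phi Y + S Y - c%:S *: phi (S Y)).

Let E_A Y : mu%:S *: phi (A Y) - (2 * c)%:S *: phi (S (A Y)) =
  (- a * mu - 2)%:S *: (Y - eta Y *: xi) + mu%:S *: phi (S Y)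
  - (2 * a * c + c * mu)%:S *: S Y - (2 * d)%:S *: phi Y.
Proof. by rewrite !wordE; vec_field. Qed.

Let L_A X Y :
  g ((a * c)%:S *: phi (S X) + d%:S *: (X - eta X *: xi) + S X) (A Y) =
  (a ^+ 2 * c + d)%:S * g (S X) Y - d%:S * g (phi X) Y
  + (a - 1)%:S * g (phi (S X)) Y + (d * d + a)%:S * (g X Y - eta X * eta Y).
Proof. by rewrite !(gE, left_phi, left_S) !wordE !innerE; fun_field. Qed.

Let nabla_A X Y : nabla X (A Y) = A (nabla X Y) +
  (eta Y *: (- a%:S *: (X - eta X *: xi - phi (S X))
             - ((d * d)%:S *: (X - eta X *: xi) + phi (S X))
             + d%:S *: phi X + c%:S *: S X)
   + eta X *: ((c * mu)%:S *: S Y - mu%:S *: phi (S Y))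
   + g (a%:S *: (X - eta X *: xi - phi (S X))
             - ((d * d)%:S *: (X - eta X *: xi) + phi (S X))
             + d%:S *: phi X + c%:S *: S X) Y *: xi).
Proof. by rewrite !nE !vderE nabla_phiSE nabla_phiE nabla_SE !gE; vec_field. Qed.

Let contact_connection_A X Y : nablab X (A Y) = nabla X (A Y)
  + (2^-1)%:S *: (eta X *: (mu%:S *: phi (A Y) - (2 * c)%:S *: phi (S (A Y))))
  + g ((a * c)%:S *: phi (S X) + d%:S *: (X - eta X *: xi) + S X) (A Y) *: xi.
Proof.
have eA : eta (A Y) = 0 by rewrite !wordE; fun_ring.
by rewrite /nablab eA scale0r add0r.
Qed.

(** R (X, Y) xi is the alternation of the derivative of A, whose three summands
    are the normal forms E_A, L_A and nabla_A. *)
Lemma contact_nullity_curvature :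
  nullity xi eta gb (h_tensor xi phib) (k + 2 - a ^+ 2) 2.
Proof.
exists nablab; first exact: contact_connection_LC.
move=> X Y; rewrite /curvature !contact_connection_xi !h_contact_tensor.
rewrite !contact_connection_A !E_A !L_A !nabla_A (torsion_free LC).
rewrite !(endoE phi, endoE S) !gE !g_xi !(swapE X Y) kE.
vec_field.
Qed.

End ContactSide.

(** * Positivity of the contact metric *)
Section Positivity.
Context {R : realType} {m : nat} {M : manifold R m}.
Local Notation C := (smooth_fun M).
Local Notation V := (vfield M).
Context (phi S : {linear V -> V}) (xi : V) (eta : {scalar V}).
Context (g : V -> V -> C) (nabla : V -> V -> V).
Context (k mu c : R).
Implicit Types X Y Z W : V.
Hypothesis PC : paracontact_calculus phi S xi eta g nabla.
Hypothesis curv : forall X Y, curvature nabla X Y xi =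
  k%:S *: (eta Y *: X - eta X *: Y) +
  mu%:S *: (eta Y *: h_tensor xi phi X - eta X *: h_tensor xi phi Y).
Hypothesis deta : forall X Y, ext_d eta X Y = g X (phi Y).
Hypothesis c_neq0 : c != 0.
Hypothesis kE : k = - 1 - c^-1 * c^-1.
Local Notation D := (eigen_distr phi eta).
Local Notation phib := (contact_tensor phi S c).
Local Notation gb := (contact_metric S eta g c).

Let gP := pc_metric PC.
Let gE := metricE gP.
Let gC := metricC gP.
Let LC := pc_LC PC.
Let eta_xi := pc_eta_xi PC.
Let phi_skew := pc_phi_skew PC.

Let gbP : sym_bilinear gb := contact_metric_bilinear c PC.
Let gbE := metricE gbP.

Lemma isotropic (s : R) X Y : is_sign s -> D s X -> D s Y -> g X Y = 0.
Proof.
move=> s1 [_ pX] [_ pY]; have := phi_skew X Y; rewrite pX pY !gE => e.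
by apply: smooth_funP => p; have := pt_eq p e; rewrite !smooth_evE;
  case: s1 => ->; lra.
Qed.

Lemma contact_metric_orthogonal (s : R) X Y :
  is_sign s -> D s X -> D (- s) Y -> gb X Y = 0.
Proof.
move=> s1 DX DY; have := S_eigen PC DY; rewrite opprK => DSY.
rewrite contact_metricE (isotropic s1 DX DSY).
by case: DX => -> _; fun_ring.
Qed.

Lemma contact_tensor_eigen (s : R) X : D s X -> D (- s) (phib X).
Proof.
move=> DX; have [eSX pSX] := S_eigen PC DX.
by split; rewrite /contact_tensor !(endoE phi, formE eta) !pSX
  !(endoE phi, formE eta) ?eSX ?pSX; [fun_ring | vec_ring].
Qed.

(** The invariant is 2 d eta ([xi, X], X), and g is isotropic on an
    eigendistribution, so that only the S-part of [xi, X] = nabla_xi X - nabla_X xi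
    contributes. *)
Lemma pang_contact_metric (s : R) X : is_sign s -> D s X ->
  pang xi eta X X = (2 * s / c)%:S * gb X X.
Proof.
move=> s1 DX; have [eX pX] := DX; have gX := isotropic s1 DX DX.
have nxi : nabla xi xi = 0.
  by rewrite (pc_nabla_xi PC) (pc_phi_xi PC) (pc_S_xi PC) oppr0 add0r.
have e_nX : eta (nabla xi X) = 0.
  have := deriv_metric LC xi X xi; rewrite -!(pc_eta PC) eX vder0 nxi gE addr0.
  by [].
have g_nX : g X (nabla xi X) = 0.
  have := deriv_metric LC xi X X; rewrite gX vder0 (gC (nabla xi X)) => e.
  by fun_lra e.
set W := bracket X xi.
have eW : eta W = 0.
  rewrite /W (torsion_free LC) !(formE eta) e_nX (pc_nabla_xi PC).
  by rewrite !(formE eta) (pc_eta_phi PC) (pc_eta_S PC); fun_ring.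
have e1 := deta X W.
have e2 : g X (phi W) = - s%:S * g X (S X).
  have -> : g X (phi W) = - g (phi X) W by rewrite phi_skew opprK.
  rewrite pX gE /W (torsion_free LC) (pc_nabla_xi PC) !gE pX !gE gX g_nX.
  by fun_ring.
rewrite /pang /lie_form -/W eta_xi eW vder1 vder0.
rewrite e2 /ext_d eW eX !vder0 in e1.
rewrite subr0 vder0 contact_metricE eX.
apply: smooth_funP => p; have := pt_eq p e1; rewrite !smooth_evE => e.
rewrite mul0r addr0 sub0r mulrN mulrA divfK //; lra.
Qed.

Context (p : M).
Hypothesis pos : forall X, D 1 X -> ~ eq_at p X 0 -> 0 < gb X X p.
Hypothesis def : forall X, D (- 1) X -> ~ eq_at p X 0 -> gb X X p != 0.
Context (n : nat).
Hypothesis dimD : forall p, has_dim_at (D 1) p n.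

(** A field X vanishing at p is perturbed to X + t e, where e is a section that
    does not vanish at p: gb is positive there for all t != 0, which forces
    0 <= gb X X p.  Such an e exists unless n = 0, where all sections vanish. *)
Lemma contact_metric_ge0_plus X : D 1 X -> 0 <= gb X X p.
Proof.
move=> DX; have [X0|/(pos DX)/ltW//] := pselect (eq_at p X 0).
have [[e De]|noe] := pselect (exists2 e, D 1 e & ~ eq_at p e 0); last first.
  have n0 : n = 0%N.
    case: n dimD => // n' /(_ p) [e [De ind _]]; exfalso; apply: noe.
    exists (e ord0) => // e0; have := ind (fun i => (i == ord0)%:R) _ ord0.
    rewrite eqxx => /(_ _)/eqP; rewrite oner_eq0 => /(_ _)/negP; apply => //.
    have -> : lincomb (fun i => (i == ord0)%:R) e = e ord0; last exact: e0.
    rewrite /lincomb (bigD1 ord0) //= big1; last first.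
      by move=> i /negPf ->; rewrite smooth_cst0 scale0r.
    by rewrite smooth_cst1 scale1r addr0.
  have -> : X = 0; last by rewrite gbE.
  apply: vfieldP => f; apply: smooth_funP => q.
  have := dimD q; rewrite n0 => -[e [_ _ /(_ X DX) [c' ->]]].
  by rewrite /lincomb big_ord0.
move=> ne; rewrite leNgt; apply/negP => a0.
have d0 := pos De ne.
set b := gb X e p.
have tP (t : R) : t != 0 -> 0 < gb X X p + 2 * t * b + t ^+ 2 * gb e e p.
  move=> t0; have DXe : D 1 (X + t%:S *: e).
    case: DX De => [eX pX] [ee pe]; split.
      by rewrite !(formE eta) eX ee; fun_ring.
    by rewrite !(endoE phi) pX pe; vec_ring.
  have := pos DXe; rewrite !gbE !smooth_evE (metricC gbP e X) -/b.
  have -> : gb X X p + t * b + (t * b + t * (t * gb e e p)) =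
    gb X X p + 2 * t * b + t ^+ 2 * gb e e p by ring.
  apply=> Xe; apply: ne => f; have := Xe f.
  rewrite !vfieldE !smooth_evE X0 !smooth_evE add0r => /eqP.
  by rewrite mulf_eq0 (negPf t0) => /eqP.
(* If gb X X p < 0, the outer terms cancel for t = r or t = - r, and the sign can
   be chosen so that the middle term is nonpositive. *)
pose r := Num.sqrt (- gb X X p / gb e e p).
have r0 : 0 < r by rewrite sqrtr_gt0 divr_gt0 // oppr_gt0.
have r2 : r ^+ 2 * gb e e p = - gb X X p.
  by rewrite sqr_sqrtr ?divfK ?gt_eqF // divr_ge0 ?oppr_ge0 ?ltW.
have [b0|b0] := leP 0 b.
  have := tP (- r); rewrite sqrrN r2 oppr_eq0 gt_eqF // => /(_ isT).
  by have := mulr_ge0 (ltW r0) b0; lra.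
have := tP r; rewrite r2 gt_eqF // => /(_ isT).
have : r * b <= 0 by rewrite pmulr_rle0 // ltW.
by lra.
Qed.

(** phib is an isometry of ker eta that maps one eigendistribution into the
    other. *)
Lemma contact_metric_ge0_minus X : D (- 1) X -> 0 <= gb X X p.
Proof.
move=> DX; have := contact_tensor_eigen DX; rewrite opprK.
move=> /contact_metric_ge0_plus; rewrite (contact_metric_tensor PC curv) //.
by case: DX => -> _; rewrite mul0r subr0.
Qed.

Lemma contact_metric_gt0 X : ~ eq_at p X 0 -> 0 < gb X X p.
Proof.
move=> X0; have [A [B [DA DB XE]]] := sign_eigen_decomp (pc_phi2 PC) (pc_eta_phi PC) X.
have gA := contact_metric_ge0_plus DA; have gB := contact_metric_ge0_minus DB.
have e : gb X X = gb A A + gb B B + eta X * eta X.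
  have AB := contact_metric_orthogonal (or_introl erefl) DA DB.
  have x1 Y : gb Y xi = eta Y by rewrite -(eta_contact_metric _ PC).
  have x2 Y : gb xi Y = eta Y by rewrite (metricC gbP) x1.
  rewrite {1 2}XE !gbE AB (metricC gbP B A) AB !x1 !x2 eta_xi.
  by case: DA DB => -> _ [-> _]; fun_ring.
rewrite e !smooth_evE lt_neqAle addr_ge0 ?addr_ge0 -?expr2 ?sqr_ge0 // andbT.
apply/eqP => /esym/eqP; rewrite paddr_eq0 ?addr_ge0 ?sqr_ge0 //.
rewrite paddr_eq0 // sqrf_eq0 => /andP[/andP[A0 B0] /eqP eX0].
apply: X0 => f; rewrite XE !vfieldE !smooth_evE eX0.
have -> : A f p = 0.
  have [->//|/(pos DA)] := pselect (eq_at p A 0).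
  by rewrite (eqP A0) ltxx.
have -> : B f p = 0.
  have [->//|/(def DB)] := pselect (eq_at p B 0).
  by rewrite B0.
by rewrite mul0r !addr0.
Qed.

Lemma eigen_lincomb (s : R) j (a : 'I_j -> R) (e : 'I_j -> V) :
  (forall i, D s (e i)) -> D s (lincomb a e).
Proof.
move=> De; rewrite /lincomb; apply: (big_ind (D s)).
- by split; rewrite ?(formE eta) ?(endoE phi) ?scaler0.
- move=> A B [eA pA] [eB pB]; split.
    by rewrite (formE eta) eA eB addr0.
  by rewrite (endoE phi) pA pB scalerDr.
move=> i _; case: (De i) => eA pA; split.
  by rewrite (formE eta) eA mulr0.
by rewrite (endoE phi) pA; vec_ring.
Qed.

(** Gram-Schmidt by dimension count: j < n fields leave a nonzero combination of
    the n basis fields orthogonal to all of them. *)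
Lemma orthonormal_frame j : (j <= n)%N -> exists v : nat -> V,
  (forall i, (i < j)%N -> D 1 (v i)) /\
  (forall i i', (i < j)%N -> (i' < j)%N -> gb (v i) (v i') p = (i == i')%:R).
Proof.
elim: j => [|j IH] jn; first by exists (fun=> 0); split.
have [v [Dv vv]] := IH (ltnW jn); have [e [De ind _]] := dimD p.
pose G : 'M[R]_(n, j) := \matrix_(i, i') gb (e i) (v i') p.
have kG : kermx G != 0.
  rewrite -mxrank_eq0 mxrank_ker subn_eq0 -ltnNge.
  by apply: leq_ltn_trans (rank_leq_col _) jn.
have /rowV0Pn [a aG a0] := kG.
have aG0 : a *m G = 0 by apply/sub_kermxP.
set Y := lincomb (a ord0) e.
have DY : D 1 Y by exact: eigen_lincomb.
have Yv i : (i < j)%N -> gb Y (v i) p = 0.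
  move=> ij; have := congr1 (fun B : 'rV[R]_j => B ord0 (Ordinal ij)) aG0.
  rewrite !mxE => <-; rewrite /Y /lincomb.
  rewrite (big_morph (fun X => gb X (v i) p) (op1 := +%R) (id1 := 0)).
  - by apply: eq_bigr => l _; rewrite gbE smooth_evE mxE.
  - by move=> A B; rewrite gbE.
  - by rewrite gbE.
have Y0 : ~ eq_at p Y 0.
  move=> /ind a00; case/negP: a0; apply/eqP/rowP => i; rewrite mxE; exact: a00.
have r0 := pos DY Y0; set r := gb Y Y p in r0.
pose y := ((Num.sqrt r)^-1)%:S *: Y.
have Dy : D 1 y.
  case: DY => eY pY; split; first by rewrite (formE eta) eY mulr0.
  by rewrite (endoE phi) pY; vec_ring.
have yv i : (i < j)%N -> gb y (v i) p = 0.
  by move=> ij; rewrite gbE smooth_evE Yv // mulr0.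
have yy : gb y y p = 1.
  rewrite !gbE !smooth_evE -/r mulrA -invfM -expr2 sqr_sqrtr ?ltW //.
  by rewrite mulVf // gt_eqF.
exists (fun i => if i == j then y else v i); split=> [i|i i'].
  by rewrite ltnS leq_eqVlt; case: eqP => [//|_] /=; exact: Dv.
rewrite !ltnS (leq_eqVlt i) (leq_eqVlt i').
have [-> _|ij /= h] := eqVneq i j; have [-> _|i'j /= h'] := eqVneq i' j.
- by rewrite yy.
- by rewrite yv // eq_sym ?(negPf i'j).
- by rewrite (metricC gbP) yv // ?(negPf ij).
- exact: vv.
Qed.

End Positivity.

(** * Signs of pair-preserving permutations *)
Section PairPermutations.
Context (n : nat).
Local Notation N := n.*2.+1.
Implicit Types (x y : 'I_N) (i : 'I_n) (s : 'S_N).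

(** The indices of 'I_(2n+1) are 0 and the pairs {2i+1, 2i+2}, i < n; [mate]
    exchanges the members of each pair and fixes 0. *)
Definition fst_of i : 'I_N := inord i.*2.+1.
Definition snd_of i : 'I_N := inord i.*2.+2.

Lemma val_fst_of i : fst_of i = i.*2.+1 :> nat.
Proof. by rewrite inordK //; have := ltn_ord i; lia. Qed.
Lemma val_snd_of i : snd_of i = i.*2.+2 :> nat.
Proof. by rewrite inordK //; have := ltn_ord i; lia. Qed.

Definition mate x : 'I_N :=
  inord (if odd x then x.+1 else x.-1).

Lemma val_mate x : mate x = (if odd x then x.+1 else x.-1) :> nat.
Proof. by rewrite inordK //; have := ltn_ord x; case: ifP; lia. Qed.

Lemma mateK : involutive mate.
Proof.
move=> x; apply: ord_inj; rewrite /= !val_mate.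
by case: (boolP (odd x)) => ox; case: ifP; lia.
Qed.

Lemma mate_fst i : mate (fst_of i) = snd_of i.
Proof.
by apply: ord_inj; rewrite val_mate val_fst_of val_snd_of /= odd_double.
Qed.

Lemma pair_cases x :
  [\/ x = ord0, exists i, x = fst_of i | exists i, x = snd_of i].
Proof.
have [/eqP x0|x0] := boolP (x == 0 :> nat); first by constructor 1; apply: ord_inj.
have lt : ((x.-1)./2 < n)%N by have := ltn_ord x; lia.
have [ox|ex] := boolP (odd x).
  by constructor 2; exists (Ordinal lt); apply: ord_inj; rewrite val_fst_of /=; lia.
by constructor 3; exists (Ordinal lt); apply: ord_inj; rewrite val_snd_of /=; lia.
Qed.

Definition pair_preserving s :=
  s ord0 = ord0 /\ forall i, s (snd_of i) = mate (s (fst_of i)).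

Lemma pair_preserving_mate s x : pair_preserving s -> s (mate x) = mate (s x).
Proof.
move=> [s0 sP]; have m0 : mate ord0 = ord0 by apply: ord_inj; rewrite val_mate.
case: (pair_cases x) => [->|[i ->]|[i ->]].
- by rewrite m0 s0 m0.
- by rewrite mate_fst sP.
- by rewrite sP mateK -mate_fst mateK.
Qed.

Lemma pair_preserving_neq0 s i : pair_preserving s -> s (fst_of i) != 0 :> nat.
Proof.
move=> [s0 _]; apply/eqP => si; have : s (fst_of i) = s ord0.
  by rewrite s0; apply: ord_inj.
by move/perm_inj => /(congr1 val); rewrite /= val_fst_of.
Qed.

(** Such a permutation is a * b, with a its restriction to the odd indices and b
    the conjugate of a by [mate], which moves only the even ones: a and b have the
    same sign. *)
Lemma parity_preserving_even s : pair_preserving s ->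
  (forall i, odd (s (fst_of i))) -> odd_perm s = false.
Proof.
move=> sP so; have so' x : odd x -> odd (s x).
  case: (pair_cases x) => [->//|[i ->]//|[i ->]].
  by rewrite val_snd_of /= negbK odd_double.
pose f x : 'I_N := if odd x then s x else x.
have f_inj : injective f.
  move=> x y; rewrite /f; case: ifP => ox; case: ifP => oy.
  - exact: perm_inj.
  - by move=> xy; have := so' _ ox; rewrite xy oy.
  - by move=> xy; have := so' _ oy; rewrite -xy ox.
  - by [].
pose t := perm (inv_inj mateK).
have tE x : t x = mate x by rewrite permE.
have tV x : (t^-1)%g x = mate x by apply: (@perm_inj _ t); rewrite permKV tE mateK.
have -> : s = (perm f_inj * perm f_inj ^ t)%g.
  apply/permP => x; rewrite conjgE !permM tV tE !permE /f.
  case: (pair_cases x) => [->|[i ->]|[i ->]].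
  - have m0 : mate ord0 = ord0 by apply: ord_inj; rewrite val_mate.
    by case: sP => s0 _; rewrite /= m0 /= m0 s0.
  - rewrite val_fst_of /= odd_double /=.
    have -> : odd (mate (s (fst_of i))) = false.
      by rewrite val_mate so /= so.
    by rewrite mateK.
  - rewrite val_snd_of /= odd_double /= -mate_fst mateK val_fst_of /= odd_double /=.
    by rewrite -(pair_preserving_mate _ sP).
by rewrite odd_permM odd_permJ addbb.
Qed.

Context (R : realType).

(** The matrix of d eta in the frame (xi, e_0, phib e_0, e_1, ...). *)
Definition pair_weight x y : R :=
  if (y == mate x) && (x != 0 :> nat) then (if odd x then -1 else 1) else 0.

(** Exchanging the two members of a pair flips the sign of the permutation and of
    one factor; this reduces to permutations that preserve parity. *)
Lemma pair_preserving_sign s : pair_preserving s ->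
  (-1) ^+ s * \prod_(i < n) pair_weight (s (fst_of i)) (s (snd_of i)) = (-1) ^+ n.
Proof.
have [j] := ubnP #|[set i : 'I_n | ~~ odd (s (fst_of i))]|.
elim: j s => // j IH s; rewrite ltnS => sj sP.
have w_eq i : pair_weight (s (fst_of i)) (s (snd_of i)) =
    if odd (s (fst_of i)) then -1 else 1.
  by rewrite /pair_weight sP.2 eqxx pair_preserving_neq0.
have [/forallP so|] := boolP [forall i, odd (s (fst_of i))].
  rewrite parity_preserving_even // mul1r (eq_bigr (fun=> -1)).
    by rewrite prodr_const card_ord.
  by move=> i _; rewrite w_eq so.
rewrite negb_forall => /existsP[i0 oi0].
pose s' : 'S_N := (tperm (fst_of i0) (snd_of i0) * s)%g.
have s'i0 : s' (fst_of i0) = mate (s (fst_of i0)).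
  by rewrite permM tpermL sP.2.
have s'i0' : s' (snd_of i0) = s (fst_of i0) by rewrite permM tpermR.
have fst_neq i : i != i0 -> (fst_of i0 != fst_of i) && (snd_of i0 != fst_of i).
  by move=> ii; rewrite -!val_eqE /= val_fst_of val_snd_of val_fst_of;
    move: ii; rewrite -val_eqE /=; lia.
have snd_neq i : i != i0 -> (fst_of i0 != snd_of i) && (snd_of i0 != snd_of i).
  by move=> ii; rewrite -!val_eqE /= val_fst_of !val_snd_of;
    move: ii; rewrite -val_eqE /=; lia.
have s'f i : i != i0 -> s' (fst_of i) = s (fst_of i).
  by move=> /fst_neq/andP[? ?]; rewrite permM tpermD.
have s'g i : i != i0 -> s' (snd_of i) = s (snd_of i).
  by move=> /snd_neq/andP[? ?]; rewrite permM tpermD.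
have s'P : pair_preserving s'.
  split.
    by rewrite permM tpermD ?sP.1 // -val_eqE /= ?val_fst_of ?val_snd_of.
  move=> i; have [->|ii] := eqVneq i i0; first by rewrite s'i0 s'i0' mateK.
  by rewrite s'f // s'g // sP.2.
have i0_neq0 := pair_preserving_neq0 i0 sP.
have oi0' : odd (s' (fst_of i0)).
  by rewrite s'i0 val_mate (negPf oi0); move: oi0 i0_neq0; lia.
have card' : (#|[set i : 'I_n | ~~ odd (s' (fst_of i))]| < j)%N.
  apply: leq_trans sj; apply: proper_card; apply/properP; split.
    apply/fintype.subsetP => i; rewrite !inE; have [->|ii] := eqVneq i i0.
      by rewrite oi0'.
    by rewrite s'f.
  by exists i0; rewrite inE ?oi0 ?oi0'.
rewrite (bigD1 i0) //= w_eq (negPf oi0); have := IH s' card' s'P.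
rewrite (bigD1 i0) //= (eq_bigr (fun i =>
  pair_weight (s (fst_of i)) (s (snd_of i)))); last first.
  by move=> i ii; rewrite s'f // s'g.
rewrite {1}/pair_weight s'P.2 eqxx (pair_preserving_neq0 _ s'P) oi0' /=.
rewrite odd_permM odd_tperm [X in (-1) ^+ (X (+) _)](_ : _ = true); last first.
  by rewrite -val_eqE /= val_fst_of val_snd_of; lia.
rewrite signr_addb => <-.
by rewrite expr1 !mulN1r mulrNN mul1r.
Qed.

Lemma pair_volume_neq0 :
  \sum_(s : 'S_N) (-1) ^+ s * ((s ord0 == ord0)%:R *
    \prod_(i < n) pair_weight (s (fst_of i)) (s (snd_of i))) != 0.
Proof.
pose term (s : 'S_N) : R := (-1) ^+ s * ((s ord0 == ord0)%:R *
    \prod_(i < n) pair_weight (s (fst_of i)) (s (snd_of i))).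
rewrite -[X in X != 0]/(\sum_s term s).
have termP s : 0 <= (-1) ^+ n * term s.
  rewrite /term; have [s0|] := eqVneq (s ord0) ord0; last first.
    by rewrite mul0r !mulr0.
  have [/forallP sP|] := boolP [forall i, s (snd_of i) == mate (s (fst_of i))].
    rewrite mul1r pair_preserving_sign -?expr2 ?sqr_ge0 //.
    by split=> // i; apply/eqP.
  rewrite negb_forall => /existsP[i si].
  by rewrite (bigD1 i) //= {1}/pair_weight (negPf si) /= !(mul0r, mulr0).
have term1 : (-1) ^+ n * term 1%g = 1.
  rewrite /term perm1 eqxx mul1r pair_preserving_sign.
    by rewrite -expr2 sqrr_sign.
  by split=> [|i]; rewrite !perm1 // mate_fst.
apply/eqP => sum0; have := congr1 ( *%R ((-1) ^+ n)) sum0.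
rewrite mulr0 mulr_sumr (bigD1 1%g) //= term1 => /eqP.
rewrite gt_eqF // ltr_pwDl // sumr_ge0 // => s _; exact: termP.
Qed.

End PairPermutations.

(** * The contact volume *)
Section ContactVolume.
Context {R : realType} {n : nat} {M : manifold R n.*2.+1}.
Local Notation C := (smooth_fun M).
Local Notation V := (vfield M).

Lemma smooth_ev_sum (I : finType) (F : I -> C) (p : M) :
  (\sum_i F i) p = \sum_i F i p.
Proof. by apply: (big_morph (fun u : C => u p)). Qed.

Lemma smooth_ev_prod (I : finType) (F : I -> C) (p : M) :
  (\prod_i F i) p = \prod_i F i p.
Proof. by apply: (big_morph (fun u : C => u p)). Qed.

Lemma smooth_ev_sign (b : bool) (p : M) : ((-1) ^+ b : C) p = (-1) ^+ b.
Proof. by case: b. Qed.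

Lemma contact_form_symplectic_frame (eta : {scalar V}) :
  (forall p, exists X : 'I_n.*2.+1 -> V,
    (forall x, eta (X x) p = (x == ord0)%:R) /\
    forall x y, ext_d eta (X x) (X y) p = pair_weight R x y) ->
  contact_form eta.
Proof.
move=> frame; split=> [|p]; first exact: linearP.
have [X [eX dX]] := frame p; exists X.
rewrite /contact_volume smooth_ev_sum.
under eq_bigr => s _.
  rewrite !smooth_evM smooth_ev_sign smooth_ev_prod eX.
  under eq_bigr => i _ do rewrite dX.
  over.
exact: pair_volume_neq0.
Qed.

End ContactVolume.

(** * The contact metric structure *)
Section ContactStructure.
Context {R : realType} {n : nat} {M : manifold R n.*2.+1}.
Local Notation C := (smooth_fun M).
Local Notation V := (vfield M).
Context (phi S : {linear V -> V}) (xi : V) (eta : {scalar V}).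
Context (g : V -> V -> C) (nabla : V -> V -> V).
Context (k mu c : R).
Implicit Types X Y Z W : V.
Hypothesis PC : paracontact_calculus phi S xi eta g nabla.
Hypothesis curv : forall X Y, curvature nabla X Y xi =
  k%:S *: (eta Y *: X - eta X *: Y) +
  mu%:S *: (eta Y *: h_tensor xi phi X - eta X *: h_tensor xi phi Y).
Hypothesis deta : forall X Y, ext_d eta X Y = g X (phi Y).
Hypothesis c_neq0 : c != 0.
Hypothesis kE : k = - 1 - c^-1 * c^-1.
Local Notation D := (eigen_distr phi eta).
Local Notation phib := (contact_tensor phi S c).
Local Notation gb := (contact_metric S eta g c).
Hypothesis dimD : forall p, has_dim_at (D 1) p n.
Hypothesis pos : forall p X, D 1 X -> ~ eq_at p X 0 -> 0 < gb X X p.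
Hypothesis def : forall p X, D (- 1) X -> ~ eq_at p X 0 -> gb X X p != 0.

Let gbP : sym_bilinear gb := contact_metric_bilinear c PC.
Let gbE := metricE gbP.
Let deta_gb X Y : ext_d eta X Y = gb X (phib Y).
Proof. by rewrite (contact_metric_deta PC curv c_neq0 kE) deta. Qed.
Let gb_phib X Y : gb (phib X) (phib Y) = gb X Y - eta X * eta Y.
Proof. exact: (contact_metric_tensor PC curv). Qed.
Let phib2 X : phib (phib X) = - X + eta X *: xi.
Proof. exact: (contact_tensor2 PC curv). Qed.
Let phib_xi : phib xi = 0.
Proof. exact: (contact_tensor_xi c PC). Qed.
Let gb_xi X : gb X xi = eta X.
Proof. by rewrite -(eta_contact_metric c PC). Qed.

Lemma contact_form_eta : contact_form eta.
Proof.
apply: contact_form_symplectic_frame => p.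
have [v [Dv vv]] := orthonormal_frame PC (pos (p := p)) dimD (leqnn n).
have e0 i : (i < n)%N -> eta (v i) = 0 by move=> /Dv [].
have e0' i : (i < n)%N -> eta (phib (v i)) = 0.
  by move=> /Dv /(contact_tensor_eigen c PC) [].
have cross i j : (i < n)%N -> (j < n)%N -> gb (v i) (phib (v j)) = 0.
  move=> /Dv Di /Dv /(contact_tensor_eigen c PC) Dj.
  by apply: (contact_metric_orthogonal c PC _ Di Dj); left.
pose X (x : 'I_n.*2.+1) := if x == ord0 then xi else
  if odd x then v (x.-1)./2 else phib (v (x.-1)./2).
have X0 : X ord0 = xi by [].
have Xf i : X (fst_of i) = v i.
  rewrite /X -val_eqE /= val_fst_of /= odd_double /=.
  by congr v; rewrite doubleK.
have Xs i : X (snd_of i) = phib (v i).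
  rewrite /X -val_eqE /= val_snd_of /= odd_double /=.
  by congr (phib (v _)); rewrite uphalf_double.
have eta_xi := pc_eta_xi PC.
exists X; split=> [x|x y].
  case: (pair_cases x) => [->|[i ->]|[i ->]].
  - by rewrite X0 eqxx eta_xi.
  - by rewrite Xf e0 // -val_eqE /= val_fst_of.
  - by rewrite Xs e0' // -val_eqE /= val_snd_of.
have vvE (i j : 'I_n) : gb (v i) (v j) p = (i == j)%:R by rewrite vv.
have eta_phib Y : eta (phib Y) = 0.
  by rewrite /contact_tensor (formE eta) (pc_eta_phi PC) mulr0.
have mate_snd i : mate (snd_of i) = fst_of i by rewrite -mate_fst mateK.
have fst_eq (i j : 'I_n) : (fst_of i == fst_of j) = (i == j).
  by rewrite -!val_eqE /= !val_fst_of eqSS (inj_eq double_inj).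
have snd_eq (i j : 'I_n) : (snd_of i == snd_of j) = (i == j).
  by rewrite -(inj_eq (inv_inj (@mateK n)) (snd_of i) (snd_of j)) !mate_snd fst_eq.
have fst_snd (i j : 'I_n) : (fst_of i == snd_of j) = false.
  apply/negbTE/eqP => /(congr1 (odd \o val)) /=.
  by rewrite val_fst_of val_snd_of /= !odd_double.
have zero_fst i : (ord0 == fst_of i) = false by rewrite -val_eqE /= val_fst_of.
have zero_snd i : (ord0 == snd_of i) = false by rewrite -val_eqE /= val_snd_of.
have gb2 A (i : 'I_n) : gb A (phib (phib (v i))) = - gb A (v i).
  by rewrite phib2 e0 // !gbE mul0r addr0.
have odd_fst i : odd (fst_of i) by rewrite val_fst_of /= odd_double.
have odd_snd i : odd (snd_of i) = false by rewrite val_snd_of /= odd_double.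
have fst_neq0 i : fst_of i != 0 :> nat by rewrite val_fst_of.
have snd_neq0 i : snd_of i != 0 :> nat by rewrite val_snd_of.
rewrite deta_gb /pair_weight.
case: (pair_cases x) => [->|[i ->]|[i ->]].
- by rewrite X0 (metricC gbP) gb_xi eta_phib andbF.
- rewrite Xf mate_fst fst_neq0 odd_fst andbT.
  case: (pair_cases y) => [->|[j ->]|[j ->]].
  + by rewrite X0 phib_xi gbE zero_snd.
  + by rewrite Xf cross // fst_snd.
  + rewrite Xs gb2 // smooth_evN vvE snd_eq eq_sym.
    by case: eqP; rewrite ?oppr0.
- rewrite Xs mate_snd snd_neq0 odd_snd andbT.
  case: (pair_cases y) => [->|[j ->]|[j ->]].
  + by rewrite X0 phib_xi gbE zero_fst.
  + rewrite Xf gb_phib e0 // mul0r subr0 vvE fst_eq eq_sym.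
    by case: eqP.
  + by rewrite Xs gb2 // (metricC gbP) cross // oppr0 eq_sym fst_snd.
Qed.

Lemma contact_riemannian_structure : contact_riemannian phib xi eta gb.
Proof.
split.
- exact: contact_form_eta.
- split=> [|X]; first exact: (pc_eta_xi PC).
  by rewrite deta (metricC (pc_metric PC)) (pc_phi_skew PC) (pc_phi_xi PC)
    (metricE (pc_metric PC)) oppr0.
- exact: contact_tensor_linear.
- split=> // p X.
  exact: (contact_metric_gt0 PC curv c_neq0 kE (pos (p := p)) (def (p := p)) dimD).
split.
- exact: phib2.
- exact: phib_xi.
- by move=> X; rewrite gb_xi.
- exact: gb_phib.
- by move=> X Y; rewrite deta_gb.
Qed.

End ContactStructure.

Section Paracontact.
Context {R : realType} {m : nat} {M : manifold R m}.
Local Notation C := (smooth_fun M).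
Local Notation V := (vfield M).
Context (phi : {linear V -> V}) (xi : V) (eta : {scalar V}).
Context (g : V -> V -> C) (nabla : V -> V -> V).
Hypotheses (eta_xi : eta xi = 1).
Hypothesis phi2 : forall X, phi (phi X) = X - eta X *: xi.
Hypotheses (gP : pseudo_riemannian_metric g).
Hypothesis g_phi : forall X Y, g (phi X) (phi Y) = - g X Y + eta X * eta Y.
Hypothesis deta : forall X Y, ext_d eta X Y = g X (phi Y).
Hypothesis LC : levi_civita g nabla.

Lemma paracontact_calculusP :
  exists S : {linear V -> V}, paracontact_calculus phi S xi eta g nabla.
Proof.
pose S : {linear V -> V} := HB.pack (para_shape phi xi nabla)
  (GRing.isLinear.Build C V V *:%R (para_shape phi xi nabla)
    (para_shape_is_linear phi xi LC)).
exists S; have [gs gn] := gP; split=> //.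
- exact: metric_inj gs gn.
- exact: (phi_xi eta_xi phi2).
- exact: (eta_phi eta_xi phi2).
- exact: (eta_metric eta_xi phi2 gs g_phi).
- exact: (phi_skew gs deta).
- by move=> X; rewrite /= /para_shape; vec_ring.
- exact: (para_shape_sym eta_xi phi2 gs g_phi deta LC).
- exact: (eta_para_shape eta_xi phi2 gs g_phi LC).
- exact: (para_shape_xi eta_xi phi2 gs gn g_phi deta LC).
- exact: (nabla_phi_closed gs deta LC).
Qed.

End Paracontact.

Theorem theorem5p6 (R : realType) (n : nat) (M : manifold R n.*2.+1)
    (phit : vfield M -> vfield M) (xi : vfield M) (eta : vfield M -> smooth_fun M)
    (gt : vfield M -> vfield M -> smooth_fun M) (kt mut : R)
    (Hpara : paracontact_nullity phit xi eta gt kt mut)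
    (Hkt : kt < - 1)
    (Hindex : forall c : R,
       c = Num.sqrt (- 1 - kt) \/ c = - Num.sqrt (- 1 - kt) ->
       constant_index gt (eigen_distr (phit \o h_tensor xi phit) eta c))
    (sgn : R)
    (Hdef : (sgn = 1 /\ positive_definite phit xi eta) \/
            (sgn = - 1 /\ negative_definite phit xi eta)) :
  let phi : vfield M -> vfield M :=
    fun X => (sgn / Num.sqrt (- 1 - kt))%:S *: h_tensor xi phit X in
  let g : vfield M -> vfield M -> smooth_fun M :=
    fun X Y => - ext_d eta X (phi Y) + eta X * eta Y in
  contact_riemannian phi xi eta g /\
  contact_nullity phi xi eta g (kt + 2 - (1 - mut / 2) ^+ 2) 2.
Proof.
have [[[phi_lin eta_lin eta_xi phi2 dimD] gP g_phi deta] [nabla LC curv]] := Hpara.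
pose phi : {linear vfield M -> vfield M} := HB.pack phit
  (GRing.isLinear.Build _ _ _ _ phit phi_lin).
pose etaL : {scalar vfield M} := HB.pack eta
  (GRing.isLinear.Build _ _ _ _ eta eta_lin).
have [S PC] := @paracontact_calculusP _ _ _ phi xi etaL gt nabla eta_xi phi2 gP
  g_phi deta LC.
set lam := Num.sqrt (- 1 - kt).
have lam_gt0 : 0 < lam by rewrite sqrtr_gt0; lra.
have lam2 : lam ^+ 2 = - 1 - kt by rewrite sqr_sqrtr //; lra.
set c := sgn / lam => phib gb.
have sgn_sign : is_sign sgn by case: Hdef => -[-> _]; [left|right].
have sgn2 : sgn * sgn = 1 by case: sgn_sign => ->; ring.
have sgn_neq0 : sgn != 0 by apply/eqP => s0; move: sgn2; rewrite s0; lra.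
have c_neq0 : c != 0 by rewrite mulf_neq0 // invr_eq0 gt_eqF.
have cV : c^-1 = sgn * lam.
  by rewrite invfM invrK; congr (_ * _); apply: (mulfI sgn_neq0); rewrite sgn2 mulfV.
have kE : kt = - 1 - c^-1 * c^-1.
  by rewrite cV mulrACA sgn2 mul1r -expr2 lam2; ring.
have phibE : phib = contact_tensor phi S c.
  by apply/funext => X; rewrite /phib (h_tensorE PC).
have gbE : gb = contact_metric S etaL gt c.
  apply/funext => X; apply/funext => Y; rewrite contact_metricE /gb phibE deta.
  rewrite -[phit]/(phi : _ -> _) /contact_tensor (endoE phi) (pc_phi2 PC) (pc_eta_S PC).
  by rewrite scale0r subr0 (metricE (pc_metric PC)).
have pangE (s : R) p X : is_sign s -> eigen_distr phit eta s X ->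
    pang xi eta X X p = 2 * s * sgn * lam * contact_metric S etaL gt c X X p.
  move=> s1 DX; rewrite (pang_contact_metric PC deta c_neq0 s1 DX) smooth_evM.
  by rewrite smooth_evC cV !mulrA.
have pos p X : eigen_distr phit eta 1 X -> ~ eq_at p X 0 ->
    0 < contact_metric S etaL gt c X X p.
  move=> DX X0; have := pangE 1 p X (or_introl erefl) DX.
  case: Hdef => -[-> [/(_ p X DX X0) + _]] => /[swap] ->; rewrite mulr1.
    by rewrite mulr1 pmulr_rgt0 // mulr_gt0.
  by rewrite mulrN1 !mulNr oppr_lt0 pmulr_rgt0 // mulr_gt0.
have def p X : eigen_distr phit eta (- 1) X -> ~ eq_at p X 0 ->
    contact_metric S etaL gt c X X p != 0.
  move=> DX X0; have := pangE (- 1) p X (or_intror erefl) DX.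
  move=> e; apply/eqP => gX0; move: e; rewrite gX0 mulr0 => pang0.
  by case: Hdef => -[_ [_ [] /(_ p X DX X0)]]; rewrite pang0 ltxx.
have dimDp p := (dimD p).1.
have riem := contact_riemannian_structure PC curv deta c_neq0 kE dimDp pos def.
rewrite phibE gbE; split; first exact: riem.
split; first exact: riem.
exact: (contact_nullity_curvature PC curv c_neq0 kE).
Qed.
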